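(* Let $n\geq 1$. Let $N=A(k)^{\mathbb{N}}$, viewed as a filtered $A(k)$-module with $N^m=\{(a_d)_{d\in\mathbb{N}}\mid a_d\in A^{m-nd}(k)\}$ (where $A^j(k)=A(k)$ for $j\leq 0$), and let $M=\mathrm{Inv}(I^n,A)$, filtered by $M^m=\mathrm{Inv}(I^n,A^m)$. Then the maps $$F:N\to M,\quad (a_d)_d\mapsto \sum_d a_d\,g_n^d,\qquad\qquad G:M\to N,\quad \alpha\mapsto (\alpha^{[d]}(0))_d$$ are mutually inverse isomorphisms of filtered $A(k)$-modules, where $\alpha^{[d]}=\alpha^{s+,s-}$ if $d=2s$ and $\alpha^{[d]}=\alpha^{(s+1)+,s-}$ if $d=2s+1$.
   Context: Setting. $k$ is a field of characteristic $\neq 2$; $K,L$ denote field extensions of $k$. Quadratic forms are nondegenerate. $GW(K)$, $W(K)$ are the Grothendieck–Witt and Witt rings; $\hat I(K)\subset GW(K)$ is the ideal of elements of virtual dimension $0$ and $I(K)\subset W(K)$ the fundamental ideal; the projection $\hat I(K)\to I(K)$ is an isomorphism, and $\hat I^n(K)$ and $I^n(K)$ are identified. $\langle\langle a\rangle\rangle=\langle1\rangle-\langle a\rangle\in\hat I(K)$, $\langle\langle a_1,\dots,a_n\rangle\rangle=\prod\langle\langle a_i\rangle\rangle$, and $\mathrm{Pf}_n(K)$ is the set of these $n$-fold Pfister elements. For functors $F$ (to sets) and $H$ (to abelian groups) on field extensions of $k$, $\mathrm{Inv}(F,H)$ is the group of natural transformations $F\to H$. $A$ is a functor from field extensions of $k$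 to filtered commutative rings $A(K)=A^0(K)\supset A^1(K)\supset\cdots$, with $\bigcap_nA^n(K)=0$, together with a natural map $f_1:I(K)\to A^1(K)$ such that: (i) $\langle\langle a_1,\dots,a_n\rangle\rangle\mapsto\{a_1,\dots,a_n\}:=f_1(\langle\langle a_1\rangle\rangle)\cdots f_1(\langle\langle a_n\rangle\rangle)$ is a well-defined injective map $\mathrm{Pf}_n(K)\to A^n(K)$; (ii) for all $n\geq1$ this map extends to a group morphism $f_n:I^n(K)\to A^n(K)$; (iii) if $x\in A(K)$ satisfies $\{a\}\cdot x\in A^{d+1}(L)$ for all extensions $L/K$ and all $a\in L^*$, then $x\in A^d(K)$; (iv) for all $K$ and $n\geq 1$, every invariant of $\mathrm{Pf}_n$ over $K$ (i.e. on extensions of $K$) with values in $A$ is uniquely of the form $x+y f_n$ with $x,y\in A(K)$. (Examples: $A=W$ with $f_1=\mathrm{Id}$; $A=H^*(-,\mu_2)$ with $f_1=e_1$.) For $\varepsilon=\pm1$ there is a unique operator $\Phi^\varepsilon:M\to M$, $\alpha\mapsto\alpha^\varepsilon$, with $\alpha(q+\varepsilon\varphi)=\alpha(q)+\varepsilon f_n(\varphi)\alpha^\varepsilon(q)$ for all $K$, $q\in I^n(K)$, $\varphi\in\mathrm{Pf}_n(K)$; write $\alpha^+,\alpha^-$. The operators $\Phi^+$ and $\Phi^-$ commute, and $\alpha^{s+,t-}=(\Phi^+)^s(\Phi^-)^t(\alpha)$. The invariants $g_n^d\in\mathrm{Inv}(I^n,A^{nd})$ are the unique ones such that $g_n^0=1$;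 $g_n^{d+1}(0)=0$ for all $d\geq0$; $(g_n^{d+1})^-=g_n^d$ if $d$ is even; $(g_n^{d+1})^+=g_n^d$ if $d$ is odd. For each $q\in I^n(K)$ one has $g_n^d(q)=0$ for $d$ large, so the sum defining $F$ is pointwise finite. $\alpha(0)\in A(k)$ is the value of $\alpha$ at $0\in I^n(k)$. *)

(* Defs.v *)
From HB Require Import structures.
From mathcomp Require Import all_boot all_order all_algebra mxtens.
From mathcomp Require Import boolp classical_sets functions cardinality fsbigop.
From mathcomp Require Import ring.
Set Implicit Arguments.
Unset Strict Implicit.
Unset Printing Implicit Defensive.
Import GRing.Theory.
Local Open Scope ring_scope.
Local Open Scope quotient_scope.

(* Nondegenerate quadratic forms, given by the Gram matrix of the associated  *)
(* symmetric bilinear form b; the quadratic form is x |-> b(x, x).  This is   *)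
(* the usual dictionary in characteristic different from 2, the only case in  *)
(* which these definitions are used.                                          *)
Record qform (K : fieldType) := QForm {
  qdim : nat;
  qmx : 'M[K]_qdim;
  qmxP : (qmx^T == qmx) && (qmx \in unitmx) }.

HB.instance Definition _ (K : fieldType) := gen_eqMixin (qform K).
HB.instance Definition _ (K : fieldType) := gen_choiceMixin (qform K).

(* Two forms, possibly of different sizes, are isometric when some linear     *)
(* isomorphism v |-> v *m P of row vectors carries one to the other.          *)
Definition isometric (K : fieldType) (q r : qform K) : Prop :=
  exists (P : 'M[K]_(qdim q, qdim r)) (Q : 'M[K]_(qdim r, qdim q)),
    [/\ P *m Q = 1%:M, Q *m P = 1%:M & qmx q = P *m qmx r *m P^T].

Definition isometricb (K : fieldType) (q r : qform K) : bool := `[< isometric q r >].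

Section Isometry.
Variable K : fieldType.
Implicit Types q r s t : qform K.

Lemma isometric_refl q : isometric q q.
Proof. by exists 1%:M, 1%:M; rewrite !mul1mx trmx1 mulmx1. Qed.

Lemma isometric_sym q r : isometric q r -> isometric r q.
Proof.
move=> [P [Q [PQ QP E]]]; exists Q, P; split=> //.
by rewrite E !mulmxA QP mul1mx -mulmxA -trmx_mul QP trmx1 mulmx1.
Qed.

Lemma isometric_trans r q s : isometric q r -> isometric r s -> isometric q s.
Proof.
move=> [P [Q [PQ QP E]]] [P' [Q' [PQ' QP' E']]].
exists (P *m P'), (Q' *m Q); split.
- by rewrite mulmxA -(mulmxA P) PQ' mulmx1.
- by rewrite mulmxA -(mulmxA Q') QP mulmx1.
- by rewrite E E' trmx_mul !mulmxA.
Qed.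

Lemma isometricb_equiv : equiv_class_of (@isometricb K).
Proof.
split=> [q|q r|r q s].
- exact/asboolP/isometric_refl.
- by apply/idP/idP => /asboolP/isometric_sym/asboolP.
- by move=> /asboolP h /asboolP h'; exact/asboolP/(isometric_trans h h').
Qed.

Lemma reindex_isometric q r (f : 'I_(qdim q) -> 'I_(qdim r))
    (g : 'I_(qdim r) -> 'I_(qdim q)) :
  cancel f g -> cancel g f -> (forall i j, qmx q i j = qmx r (f i) (f j)) ->
  isometric q r.
Proof.
move=> fK gK E.
exists (\matrix_(i, j) (f i == j)%:R), (\matrix_(j, i) (f i == j)%:R); split.
- apply/matrixP=> i j; rewrite !mxE (bigD1 (f i)) //= !mxE eqxx mul1r big1.
    by rewrite addr0 (inj_eq (can_inj fK)) eq_sym.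
  by move=> l lN; rewrite !mxE eq_sym (negbTE lN) mul0r.
- apply/matrixP=> i j; rewrite !mxE (bigD1 (g i)) //= !mxE gK eqxx mul1r big1.
    by rewrite addr0.
  by move=> l lN; rewrite !mxE (can2_eq fK gK) (negbTE lN) mul0r.
- apply/matrixP=> i j; rewrite E !mxE (bigD1 (f j)) //= !mxE eqxx mulr1.
  rewrite (bigD1 (f i)) //= !mxE eqxx mul1r big1 => [|l lN]; last first.
    by rewrite !mxE eq_sym (negbTE lN) mul0r.
  rewrite big1 ?addr0 // => l lN.
  by rewrite !mxE [f j == l]eq_sym (negbTE lN) mulr0.
Qed.

Lemma index_isometric (I : finType) q r (u : I -> 'I_(qdim q)) u'
    (v : I -> 'I_(qdim r)) v' :
  cancel u u' -> cancel v v' -> #|I| = qdim q -> #|I| = qdim r ->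
  (forall i j, qmx q (u i) (u j) = qmx r (v i) (v j)) -> isometric q r.
Proof.
move=> uK vK cq cr E.
have uK' : cancel u' u.
  apply/(bij_can_sym (inj_card_bij (can_inj uK) _)) => //.
  by rewrite card_ord cq.
have vK' : cancel v' v.
  apply/(bij_can_sym (inj_card_bij (can_inj vK) _)) => //.
  by rewrite card_ord cr.
apply: (@reindex_isometric _ _ (v \o u') (u \o v')).
- by move=> i /=; rewrite vK uK'.
- by move=> i /=; rewrite uK vK'.
- by move=> i j; rewrite -{1}[i]uK' -{1}[j]uK' E.
Qed.

End Isometry.

Definition Kstar (K : fieldType) := {a : K | a != 0}.

Section Operations.
Variable K : fieldType.
Implicit Types q r s t : qform K.

Lemma qzero_subproof : ((0 : 'M[K]_0)^T == 0) && ((0 : 'M[K]_0) \in unitmx).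
Proof. by rewrite trmx0 eqxx unitmxE det_mx00 unitr1. Qed.
Definition qzero := QForm qzero_subproof.

Lemma qdiag1_subproof (a : Kstar K) :
  ((sval a)%:M^T == (sval a)%:M :> 'M_1) && ((sval a)%:M \in @unitmx K 1).
Proof. by rewrite tr_scalar_mx eqxx unitmxE det_scalar unitrX // unitfE (svalP a). Qed.
Definition qdiag1 a := QForm (qdiag1_subproof a).

Definition unit1 : Kstar K := exist _ 1 (oner_neq0 K).

Lemma unitN1_subproof : (-1 : K) != 0.
Proof. by rewrite oppr_eq0 oner_eq0. Qed.
Definition unitN1 : Kstar K := exist _ (-1) unitN1_subproof.

Lemma qsum_subproof q r (M := block_mx (qmx q) 0 0 (qmx r)) :
  (M^T == M) && (M \in unitmx).
Proof.
have /andP[/eqP sq uq] := qmxP q; have /andP[/eqP sr ur] := qmxP r.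
rewrite /M tr_block_mx !trmx0 sq sr eqxx unitmxE det_ublock unitrM.
by rewrite -!unitmxE uq ur.
Qed.
Definition qsum q r := QForm (qsum_subproof q r).

Lemma tens1 m n : (1%:M : 'M[K]_m) *t (1%:M : 'M[K]_n) = 1%:M.
Proof.
apply/matrixP=> i j.
case: (mxtens_indexP i) => i1 i2; case: (mxtens_indexP j) => j1 j2.
rewrite tensmxE !mxE (inj_eq (can_inj (@mxtens_indexK m n))) xpair_eqE.
by rewrite -natrM mulnb.
Qed.

Lemma qtens_subproof q r (M := qmx q *t qmx r) : (M^T == M) && (M \in unitmx).
Proof.
have /andP[/eqP sq uq] := qmxP q; have /andP[/eqP sr ur] := qmxP r.
rewrite /M trmx_tens sq sr eqxx /=.
suff /mulmx1_unit[] : (qmx q *t qmx r) *m (invmx (qmx q) *t invmx (qmx r)) = 1%:M.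
  by [].
by rewrite tensmx_mul !mulmxV // tens1.
Qed.
Definition qtens q r := QForm (qtens_subproof q r).

Lemma qsum_isometric q q' r r' : isometric q q' -> isometric r r' ->
  isometric (qsum q r) (qsum q' r').
Proof.
move=> [P [Q [PQ QP E]]] [P' [Q' [PQ' QP' E']]].
exists (block_mx P 0 0 P'), (block_mx Q 0 0 Q'); rewrite /=; split.
- by rewrite mulmx_block !(mul0mx, mulmx0, addr0, add0r) PQ PQ' -scalar_mx_block.
- by rewrite mulmx_block !(mul0mx, mulmx0, addr0, add0r) QP QP' -scalar_mx_block.
- rewrite tr_block_mx !trmx0 !mulmx_block.
  by rewrite !(mul0mx, mulmx0, addr0, add0r) E E'.
Qed.

Lemma qtens_isometric q q' r r' : isometric q q' -> isometric r r' ->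
  isometric (qtens q r) (qtens q' r').
Proof.
move=> [P [Q [PQ QP E]]] [P' [Q' [PQ' QP' E']]].
exists (P *t P'), (Q *t Q'); rewrite /= !tensmx_mul PQ PQ' QP QP' !tens1.
by rewrite trmx_tens !tensmx_mul E E'.
Qed.

Let qsumE q r (i j : 'I_(qdim q + qdim r)) : qmx (qsum q r) i j =
  match fintype.split i, fintype.split j with
  | inl i, inl j => qmx q i j | inr i, inr j => qmx r i j | _, _ => 0 end.
Proof. by rewrite /= !mxE; case: fintype.split => x; rewrite !mxE; case: fintype.split => y; rewrite ?mxE. Qed.

Let split_l m n (i : 'I_m) : fintype.split (lshift n i) = inl i.
Proof. exact: (unsplitK (inl i)). Qed.
Let split_r m n (i : 'I_n) : fintype.split (rshift m i) = inr i.
Proof. exact: (unsplitK (inr i)). Qed.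


Let qsum_ll q r i j : qmx (qsum q r) (lshift _ i) (lshift _ j) = qmx q i j.
Proof. by rewrite qsumE !split_l. Qed.
Let qsum_lr q r i j : qmx (qsum q r) (lshift _ i) (rshift _ j) = 0.
Proof. by rewrite qsumE split_l split_r. Qed.
Let qsum_rl q r i j : qmx (qsum q r) (rshift _ i) (lshift _ j) = 0.
Proof. by rewrite qsumE split_l split_r. Qed.
Let qsum_rr q r i j : qmx (qsum q r) (rshift _ i) (rshift _ j) = qmx r i j.
Proof. by rewrite qsumE !split_r. Qed.
Let qsumEs := (qsum_ll, qsum_lr, qsum_rl, qsum_rr).
Let qtensE q r i j i' j' : qmx (qtens q r) (mxtens_index (i, i')) (mxtens_index (j, j'))
  = qmx q i j * qmx r i' j'.
Proof. exact: tensmxE. Qed.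
Let splitE := (split_l, split_r).

Lemma qsumC q r : isometric (qsum q r) (qsum r q).
Proof.
pose v (x : 'I_(qdim q) + 'I_(qdim r)) : 'I_(qdim r + qdim q) :=
  match x with inl i => rshift _ i | inr i => lshift _ i end.
pose v' (i : 'I_(qdim r + qdim q)) := match fintype.split i with
  inl i => inr i | inr i => inl i end : 'I_(qdim q) + 'I_(qdim r).
apply: (@index_isometric _ ('I_(qdim q) + 'I_(qdim r))%type (qsum q r) (qsum r q)
  (@unsplit _ _) (@fintype.split _ _) v v').
- exact: unsplitK.
- by case=> i; rewrite /v' !splitE.
- by rewrite card_sum !card_ord.
- by rewrite card_sum !card_ord addnC.
- by case=> i; case=> j; rewrite /unsplit !qsumEs.
Qed.

Lemma qsumA q r s : isometric (qsum q (qsum r s)) (qsum (qsum q r) s).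
Proof.
pose I := ('I_(qdim q) + ('I_(qdim r) + 'I_(qdim s)))%type.
pose u (x : I) : 'I_(qdim q + (qdim r + qdim s)) :=
  match x with inl i => lshift _ i | inr (inl i) => rshift _ (lshift _ i)
  | inr (inr i) => rshift _ (rshift _ i) end.
pose u' (i : 'I_(qdim q + (qdim r + qdim s))) : I :=
  match fintype.split i with inl i => inl i | inr i => inr (fintype.split i) end.
pose v (x : I) : 'I_(qdim q + qdim r + qdim s) :=
  match x with inl i => lshift _ (lshift _ i) | inr (inl i) => lshift _ (rshift _ i)
  | inr (inr i) => rshift _ i end.
pose v' (i : 'I_(qdim q + qdim r + qdim s)) : I := match fintype.split i with
  inl i => match fintype.split i with inl i => inl i | inr i => inr (inl i) end
  | inr i => inr (inr i) end.
apply: (@index_isometric _ I (qsum q (qsum r s)) (qsum (qsum q r) s) u u' v v').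
- by case=> [i|[i|i]]; rewrite /u' !splitE.
- by case=> [i|[i|i]]; rewrite /v' !splitE.
- by rewrite !card_sum !card_ord.
- by rewrite !card_sum !card_ord addnA.
- by case=> [i|[i|i]]; case=> [j|[j|j]]; rewrite /u /v !qsumEs.
Qed.

Lemma qsum0 q : isometric (qsum qzero q) q.
Proof.
apply: (@index_isometric _ 'I_(qdim q) (qsum qzero q) q (@rshift 0 _)
  (fun i : 'I_(0 + qdim q) => i) id id).
- by move=> i; apply: val_inj.
- by [].
- by rewrite card_ord.
- by rewrite card_ord.
- by move=> i j; rewrite qsumEs.
Qed.

Lemma qtensC q r : isometric (qtens q r) (qtens r q).
Proof.
pose v (x : 'I_(qdim q) * 'I_(qdim r)) : 'I_(qdim r * qdim q) :=
  mxtens_index (x.2, x.1).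
pose v' (i : 'I_(qdim r * qdim q)) := ((mxtens_unindex i).2, (mxtens_unindex i).1).
apply: (@index_isometric _ ('I_(qdim q) * 'I_(qdim r))%type (qtens q r) (qtens r q)
  (@mxtens_index _ _) (@mxtens_unindex _ _) v v').
- exact: mxtens_indexK.
- by case=> i j; rewrite /v' /v mxtens_indexK.
- by rewrite card_prod !card_ord.
- by rewrite card_prod !card_ord mulnC.
- by case=> i i' [j j']; rewrite !qtensE mulrC.
Qed.

Lemma qtensA q r s : isometric (qtens q (qtens r s)) (qtens (qtens q r) s).
Proof.
pose I := ('I_(qdim q) * ('I_(qdim r) * 'I_(qdim s)))%type.
pose u (x : I) : 'I_(qdim q * (qdim r * qdim s)) :=
  mxtens_index (x.1, mxtens_index x.2).
pose u' (i : 'I_(qdim q * (qdim r * qdim s))) : I :=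
  ((mxtens_unindex i).1, mxtens_unindex (mxtens_unindex i).2).
pose v (x : I) : 'I_(qdim q * qdim r * qdim s) :=
  mxtens_index (mxtens_index (x.1, x.2.1), x.2.2).
pose v' (i : 'I_(qdim q * qdim r * qdim s)) : I :=
  let x := mxtens_unindex (mxtens_unindex i).1 in (x.1, (x.2, (mxtens_unindex i).2)).
apply: (@index_isometric _ I (qtens q (qtens r s)) (qtens (qtens q r) s) u u' v v').
- by case=> [i [j l]]; rewrite /u' /u !mxtens_indexK.
- by case=> [i [j l]]; rewrite /v' /v !mxtens_indexK.
- by rewrite !card_prod !card_ord.
- by rewrite !card_prod !card_ord mulnA.
- by case=> [i [j l]] [i' [j' l']]; rewrite !qtensE mulrA.
Qed.

Lemma qtens1 q : isometric (qtens (qdiag1 unit1) q) q.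
Proof.
apply: (@index_isometric _ 'I_(qdim q) (qtens (qdiag1 unit1) q) q
  (fun i => mxtens_index (ord0, i) : 'I_(1 * qdim q))
  (fun i : 'I_(1 * qdim q) => (mxtens_unindex i).2) id id).
- by move=> i; rewrite mxtens_indexK.
- by [].
- by rewrite card_ord /= mul1n.
- by rewrite card_ord.
- by move=> i j; rewrite qtensE !mxE eqxx mul1r.
Qed.

Lemma qtens0 q : isometric (qtens qzero q) qzero.
Proof.
apply: (@index_isometric _ 'I_0 (qtens qzero q) qzero (fun i => i : 'I_(0 * qdim q))
  (fun i : 'I_(0 * qdim q) => i) id id) => //; rewrite ?card_ord //.
by case.
Qed.

Lemma qtensDl q r s : isometric (qtens (qsum q r) s) (qsum (qtens q s) (qtens r s)).
Proof.
pose I := (('I_(qdim q) + 'I_(qdim r)) * 'I_(qdim s))%type.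
pose u (x : I) : 'I_((qdim q + qdim r) * qdim s) := mxtens_index (unsplit x.1, x.2).
pose u' (i : 'I_((qdim q + qdim r) * qdim s)) : I :=
  (fintype.split (mxtens_unindex i).1, (mxtens_unindex i).2).
pose v (x : I) : 'I_(qdim q * qdim s + qdim r * qdim s) :=
  match x.1 with inl i => lshift _ (mxtens_index (i, x.2))
  | inr i => rshift _ (mxtens_index (i, x.2)) end.
pose v' (i : 'I_(qdim q * qdim s + qdim r * qdim s)) : I :=
  match fintype.split i with inl i => (inl (mxtens_unindex i).1, (mxtens_unindex i).2)
  | inr i => (inr (mxtens_unindex i).1, (mxtens_unindex i).2) end.
apply: (@index_isometric _ I (qtens (qsum q r) s) (qsum (qtens q s) (qtens r s)) u u' v v').
- by case=> [i j]; rewrite /u' /u !mxtens_indexK unsplitK.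
- by case=> [[i|i] j]; rewrite /v' /v !splitE !mxtens_indexK.
- by rewrite card_prod card_sum !card_ord.
- by rewrite card_prod card_sum !card_ord mulnDl.
- by case=> [[i|i] l] [[j|j] m]; rewrite /u /v /unsplit qtensE !qsumEs ?mul0r ?qtensE.
Qed.

End Operations.

Canonical isometricb_equiv_rel (K : fieldType) := EquivRelPack (@isometricb_equiv K).

Definition qclass (K : fieldType) := {eq_quot (@isometricb K)}.
HB.instance Definition _ (K : fieldType) := EqQuotient.on (qclass K).
HB.instance Definition _ (K : fieldType) := Choice.on (qclass K).

Section ClassSemiring.
Variable K : fieldType.
Implicit Types x y z : qclass K.

Definition qcl (q : qform K) : qclass K := \pi q.

Lemma qclP q r : qcl q = qcl r <-> isometric q r.
Proof. by split=> [/eqmodP/asboolP|h]; last exact/eqmodP/asboolP. Qed.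

Lemma qclassP x : exists q, x = qcl q.
Proof. by exists (repr x); rewrite /qcl reprK. Qed.

Definition qcl_add x y : qclass K := qcl (qsum (repr x) (repr y)).
Definition qcl_mul x y : qclass K := qcl (qtens (repr x) (repr y)).

Lemma repr_qcl q : isometric (repr (qcl q)) q.
Proof. by apply/qclP; rewrite /qcl reprK. Qed.

Lemma qcl_addE q r : qcl_add (qcl q) (qcl r) = qcl (qsum q r).
Proof. by apply/qclP/qsum_isometric; exact: repr_qcl. Qed.

Lemma qcl_mulE q r : qcl_mul (qcl q) (qcl r) = qcl (qtens q r).
Proof. by apply/qclP/qtens_isometric; exact: repr_qcl. Qed.

Lemma qcl_addA : associative qcl_add.
Proof.
move=> x y z; have [[q ->] [r ->] [s ->]] := And3 (qclassP x) (qclassP y) (qclassP z).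
by rewrite !qcl_addE; apply/qclP/qsumA.
Qed.

Lemma qcl_addC : commutative qcl_add.
Proof.
move=> x y; have [[q ->] [r ->]] := conj (qclassP x) (qclassP y).
by rewrite !qcl_addE; apply/qclP/qsumC.
Qed.

Lemma qcl_add0 : left_id (qcl (qzero K)) qcl_add.
Proof. by move=> x; have [q ->] := qclassP x; rewrite qcl_addE; apply/qclP/qsum0. Qed.

HB.instance Definition _ := GRing.isNmodule.Build (qclass K) qcl_addA qcl_addC qcl_add0.

Lemma qcl_mulA : associative qcl_mul.
Proof.
move=> x y z; have [[q ->] [r ->] [s ->]] := And3 (qclassP x) (qclassP y) (qclassP z).
by rewrite !qcl_mulE; apply/qclP/qtensA.
Qed.

Lemma qcl_mulC : commutative qcl_mul.
Proof.
move=> x y; have [[q ->] [r ->]] := conj (qclassP x) (qclassP y).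
by rewrite !qcl_mulE; apply/qclP/qtensC.
Qed.

Lemma qcl_mul1 : left_id (qcl (qdiag1 (unit1 K))) qcl_mul.
Proof. by move=> x; have [q ->] := qclassP x; rewrite qcl_mulE; apply/qclP/qtens1. Qed.

Lemma qcl_mul0 : left_zero 0 qcl_mul.
Proof.
by move=> x; have [q ->] := qclassP x; rewrite [0]/(qcl _) qcl_mulE; apply/qclP/qtens0.
Qed.

Lemma qcl_mulDl : left_distributive qcl_mul +%R.
Proof.
move=> x y z; have [[q ->] [r ->] [s ->]] := And3 (qclassP x) (qclassP y) (qclassP z).
change (qcl_mul (qcl_add (qcl q) (qcl r)) (qcl s) =
  qcl_add (qcl_mul (qcl q) (qcl s)) (qcl_mul (qcl r) (qcl s))).
by rewrite !(qcl_mulE, qcl_addE); apply/qclP/qtensDl.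
Qed.

HB.instance Definition _ := GRing.Nmodule_isComPzSemiRing.Build (qclass K)
  qcl_mulA qcl_mulC qcl_mul1 qcl_mulDl qcl_mul0.

Lemma qcl_sum q r : qcl (qsum q r) = qcl q + qcl r.
Proof. exact/esym/qcl_addE. Qed.
Lemma qcl_tens q r : qcl (qtens q r) = qcl q * qcl r.
Proof. exact/esym/qcl_mulE. Qed.
Lemma qcl_zero : qcl (qzero K) = 0. Proof. by []. Qed.
Lemma qcl_one : qcl (qdiag1 (unit1 K)) = 1. Proof. by []. Qed.

Definition qcldim x : int := (qdim (repr x))%:Z.

Lemma isometric_dim (q r : qform K) : isometric q r -> qdim q = qdim r.
Proof.
move=> [P [Q [PQ QP _]]]; apply/eqP; rewrite eqn_leq; apply/andP; split.
  by rewrite -(mxrank1 K (qdim q)) -PQ (leq_trans (mxrankM_maxl _ _)) ?rank_leq_col.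
by rewrite -(mxrank1 K (qdim r)) -QP (leq_trans (mxrankM_maxl _ _)) ?rank_leq_col.
Qed.

Lemma qcldimE q : qcldim (qcl q) = (qdim q)%:Z.
Proof. by rewrite /qcldim (isometric_dim (repr_qcl q)). Qed.

Lemma qcldim_nmod : nmod_morphism qcldim.
Proof.
split=> [|x y]; first by rewrite -qcl_zero qcldimE.
have [[q ->] [r ->]] := conj (qclassP x) (qclassP y).
by rewrite -qcl_sum !qcldimE /= PoszD.
Qed.

Lemma qcldim_monoid : monoid_morphism qcldim.
Proof.
split=> [|x y]; first by rewrite -qcl_one qcldimE.
have [[q ->] [r ->]] := conj (qclassP x) (qclassP y).
by rewrite -qcl_tens !qcldimE /= PoszM.
Qed.

HB.instance Definition _ := GRing.isNmodMorphism.Build (qclass K) int qcldim qcldim_nmod.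
HB.instance Definition _ := GRing.isMonoidMorphism.Build (qclass K) int qcldim qcldim_monoid.

End ClassSemiring.

(* The pair (a, b) stands for the formal difference a - b.                    *)
Section Grothendieck.
Variable S : comPzSemiRingType.

Definition groth_rel (x y : S * S) : bool :=
  `[< exists e : S, x.1 + y.2 + e = y.1 + x.2 + e >].

Lemma groth_rel_equiv : equiv_class_of groth_rel.
Proof.
split=> [x|x y|y x z].
- by apply/asboolP; exists 0.
- by apply/idP/idP => /asboolP[e E]; apply/asboolP; exists e.
- move=> /asboolP[e E] /asboolP[f F]; apply/asboolP; exists (y.1 + y.2 + e + f).
  have -> : x.1 + z.2 + (y.1 + y.2 + e + f) = x.1 + y.2 + e + (y.1 + z.2 + f) by ring.
  by rewrite E F; ring.
Qed.
Canonical groth_equiv_rel := EquivRelPack groth_rel_equiv.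

Definition groth := {eq_quot groth_rel}.
HB.instance Definition _ := EqQuotient.on groth.
HB.instance Definition _ := Choice.on groth.
Implicit Types u v w : groth.

Definition gdiff (a b : S) : groth := \pi_groth (a, b).

Lemma gdiffP a b c d : gdiff a b = gdiff c d <-> exists e, a + d + e = c + b + e.
Proof. by split=> [/eqmodP/asboolP|h]; last exact/eqmodP/asboolP. Qed.

Lemma grothP u : exists a b, u = gdiff a b.
Proof. by exists (repr u).1, (repr u).2; rewrite /gdiff -surjective_pairing reprK. Qed.

Lemma repr_gdiff a b :
  exists e, (repr (gdiff a b)).1 + b + e = a + (repr (gdiff a b)).2 + e.
Proof. by apply/gdiffP; rewrite /gdiff -surjective_pairing reprK. Qed.

Definition groth_add u v := gdiff ((repr u).1 + (repr v).1) ((repr u).2 + (repr v).2).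
Definition groth_opp u := gdiff (repr u).2 (repr u).1.
Definition groth_mul u v :=
  gdiff ((repr u).1 * (repr v).1 + (repr u).2 * (repr v).2)
        ((repr u).1 * (repr v).2 + (repr u).2 * (repr v).1).

Lemma groth_addE a b c d : groth_add (gdiff a b) (gdiff c d) = gdiff (a + c) (b + d).
Proof.
apply/gdiffP; have [[e E] [f F]] := conj (repr_gdiff a b) (repr_gdiff c d).
case: (repr _) E => a' b' /= E; case: (repr _) F => c' d' /= F; exists (e + f).
have -> : a' + c' + (b + d) + (e + f) = (a' + b + e) + (c' + d + f) by ring.
by rewrite E F; ring.
Qed.

Lemma groth_oppE a b : groth_opp (gdiff a b) = gdiff b a.
Proof.
apply/gdiffP; have [e E] := repr_gdiff a b.
case: (repr _) E => a' b' /= E; exists e.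
by rewrite [b' + a]addrC -E addrC [b + a']addrC addrC.
Qed.

Lemma gdiff_mull a b a' b' c d : gdiff a b = gdiff a' b' ->
  gdiff (a * c + b * d) (a * d + b * c) = gdiff (a' * c + b' * d) (a' * d + b' * c).
Proof.
move=> /gdiffP[e E]; apply/gdiffP; exists (e * c + e * d).
transitivity ((a + b' + e) * c + (a' + b + e) * d); first by ring.
by rewrite E -{2}E; ring.
Qed.

Lemma groth_mulE a b c d :
  groth_mul (gdiff a b) (gdiff c d) = gdiff (a * c + b * d) (a * d + b * c).
Proof.
have reprE u : gdiff (repr u).1 (repr u).2 = u.
  by rewrite /gdiff -surjective_pairing reprK.
rewrite /groth_mul; set x := repr (gdiff a b); set y := repr (gdiff c d).
rewrite (@gdiff_mull _ _ a b) ?reprE //.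
have -> : a * y.1 + b * y.2 = y.1 * a + y.2 * b by ring.
have -> : a * y.2 + b * y.1 = y.1 * b + y.2 * a by ring.
rewrite (@gdiff_mull _ _ c d) ?reprE //.
by congr gdiff; ring.
Qed.

Lemma groth_addA : associative groth_add.
Proof.
move=> u v w; have [[a [b ->]] [c [d ->]] [e [f ->]]] := And3 (grothP u) (grothP v) (grothP w).
by rewrite !groth_addE !addrA.
Qed.

Lemma groth_addC : commutative groth_add.
Proof.
move=> u v; have [[a [b ->]] [c [d ->]]] := conj (grothP u) (grothP v).
by rewrite !groth_addE addrC [b + d]addrC.
Qed.

Lemma groth_add0 : left_id (gdiff 0 0) groth_add.
Proof. by move=> u; have [a [b ->]] := grothP u; rewrite groth_addE !add0r. Qed.

Lemma groth_addN : left_inverse (gdiff 0 0) groth_opp groth_add.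
Proof.
move=> u; have [a [b ->]] := grothP u; rewrite groth_oppE groth_addE.
by apply/gdiffP; exists 0; ring.
Qed.

HB.instance Definition _ :=
  GRing.isZmodule.Build groth groth_addA groth_addC groth_add0 groth_addN.

Lemma groth_mulA : associative groth_mul.
Proof.
move=> u v w; have [[a [b ->]] [c [d ->]] [e [f ->]]] := And3 (grothP u) (grothP v) (grothP w).
by rewrite !groth_mulE; congr gdiff; ring.
Qed.

Lemma groth_mulC : commutative groth_mul.
Proof.
move=> u v; have [[a [b ->]] [c [d ->]]] := conj (grothP u) (grothP v).
by rewrite !groth_mulE; congr gdiff; ring.
Qed.

Lemma groth_mul1 : left_id (gdiff 1 0) groth_mul.
Proof.
by move=> u; have [a [b ->]] := grothP u; rewrite groth_mulE; congr gdiff; ring.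
Qed.

Lemma groth_mulDl : left_distributive groth_mul groth_add.
Proof.
move=> u v w; have [[a [b ->]] [c [d ->]] [e [f ->]]] := And3 (grothP u) (grothP v) (grothP w).
by rewrite !(groth_addE, groth_mulE); congr gdiff; ring.
Qed.

HB.instance Definition _ := GRing.Zmodule_isComPzRing.Build groth
  groth_mulA groth_mulC groth_mul1 groth_mulDl.

Definition ginj (a : S) : groth := gdiff a 0.

Lemma ginj_nmod : nmod_morphism ginj.
Proof. by split=> // a b; rewrite [RHS]groth_addE addr0. Qed.

Lemma ginj_monoid : monoid_morphism ginj.
Proof. by split=> // a b; rewrite [RHS]groth_mulE /ginj; congr gdiff; ring. Qed.

HB.instance Definition _ := GRing.isNmodMorphism.Build S groth ginj ginj_nmod.
HB.instance Definition _ := GRing.isMonoidMorphism.Build S groth ginj ginj_monoid.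

Lemma gdiffE a b : gdiff a b = ginj a - ginj b.
Proof.
change (gdiff a b = groth_add (gdiff a 0) (groth_opp (gdiff b 0))).
by rewrite groth_oppE groth_addE addr0 add0r.
Qed.

End Grothendieck.

Section GrothendieckLift.
Variables (S : comPzSemiRingType) (R : comPzRingType) (f : {rmorphism S -> R}).

Definition groth_lift (u : groth S) : R := f (repr u).1 - f (repr u).2.

Lemma groth_liftE a b : groth_lift (gdiff a b) = f a - f b.
Proof.
have [e] := repr_gdiff a b; rewrite /groth_lift; case: (repr _) => c d /= E.
have /eqP := congr1 f E; rewrite !rmorphD /= (inj_eq (addIr _)) => /eqP {}E.
by apply/eqP; rewrite subr_eq addrAC -E addrK.
Qed.

Lemma groth_lift_zmod : zmod_morphism groth_lift.
Proof.
move=> u v; have [[a [b ->]] [c [d ->]]] := conj (grothP u) (grothP v).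
have -> : gdiff a b - gdiff c d = gdiff (a + d) (b + c).
  by rewrite !gdiffE !raddfD /=; ring.
by rewrite !groth_liftE !rmorphD /=; ring.
Qed.

Lemma groth_lift_monoid : monoid_morphism groth_lift.
Proof.
split=> [|u v].
  by rewrite [1]/(gdiff 1 0) groth_liftE rmorph1 rmorph0 subr0.
have [[a [b ->]] [c [d ->]]] := conj (grothP u) (grothP v).
rewrite [_ * _ in LHS]groth_mulE !groth_liftE !rmorphD /= !rmorphM; ring.
Qed.

HB.instance Definition _ :=
  GRing.isZmodMorphism.Build (groth S) R groth_lift groth_lift_zmod.
HB.instance Definition _ :=
  GRing.isMonoidMorphism.Build (groth S) R groth_lift groth_lift_monoid.

End GrothendieckLift.

Definition GW (K : fieldType) := groth (qclass K).
HB.instance Definition _ (K : fieldType) := GRing.ComPzRing.on (GW K).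

Definition gwform (K : fieldType) (q : qform K) : GW K := ginj (qcl q).
Definition gwdiag (K : fieldType) (a : Kstar K) : GW K := gwform (qdiag1 a).
Definition vdim (K : fieldType) : GW K -> int := groth_lift (@qcldim K).
HB.instance Definition _ (K : fieldType) := GRing.RMorphism.copy (@vdim K)
  (groth_lift (@qcldim K)).

Lemma vdim_gwform (K : fieldType) (q : qform K) : vdim (gwform q) = (qdim q)%:Z.
Proof. by rewrite /vdim /gwform groth_liftE raddf0 subr0 /= qcldimE. Qed.

Lemma GWP (K : fieldType) (x : GW K) : exists q r, x = gwform q - gwform r.
Proof.
have [a [b ->]] := grothP x; have [[q ->] [r ->]] := conj (qclassP a) (qclassP b).
by exists q, r; rewrite gdiffE.
Qed.

Lemma GW_nontrivial (K : fieldType) : (1 : GW K) != 0.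
Proof. by apply/eqP => /(congr1 (@vdim K)); rewrite rmorph1 rmorph0. Qed.

HB.instance Definition _ (K : fieldType) :=
  GRing.PzSemiRing_isNonZero.Build (GW K) (@GW_nontrivial K).

Definition hypplane (K : fieldType) : GW K := gwdiag (unit1 K) + gwdiag (unitN1 K).
Definition hypideal (K : fieldType) : {pred GW K} :=
  fun x => `[< exists y, x = y * hypplane K >].

Lemma vdim_hypplane (K : fieldType) : vdim (hypplane K) = 2.
Proof. by rewrite /hypplane /gwdiag rmorphD /= !vdim_gwform. Qed.

Lemma hypideal_idealr (K : fieldType) : idealr_closed (@hypideal K).
Proof.
split.
- by apply/asboolP; exists 0; rewrite mul0r.
- apply/asboolP => -[y /(congr1 (@vdim K))].
  rewrite rmorph1 rmorphM /= vdim_hypplane => /(congr1 (fun z => (2 %| z)%Z)).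
  by rewrite dvdz_mull.
- move=> a u v /asboolP[y ->] /asboolP[z ->]; apply/asboolP; exists (a * y + z).
  by rewrite mulrDl mulrA.
Qed.
HB.instance Definition _ (K : fieldType) :=
  isIdealr.Build (GW K) (@hypideal K) (@hypideal_idealr K).

Definition W (K : fieldType) := {ideal_quot (@hypideal K)}.
HB.instance Definition _ (K : fieldType) := GRing.ComNzRing.on (W K).

Definition wproj (K : fieldType) : GW K -> W K := \pi_(W K).
HB.instance Definition _ (K : fieldType) := GRing.RMorphism.on (@wproj K).

Lemma WP (K : fieldType) (w : W K) : exists x, w = wproj x.
Proof. by exists (repr w); rewrite /wproj reprK. Qed.

Section ScalarExtension.
Variables (K L : fieldType) (h : {rmorphism K -> L}).

Lemma qform_map_subproof (q : qform K) (M := map_mx h (qmx q)) :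
  (M^T == M) && (M \in unitmx).
Proof.
have /andP[/eqP sq uq] := qmxP q.
by rewrite /M map_trmx sq eqxx map_unitmx uq.
Qed.
Definition qform_map (q : qform K) := QForm (qform_map_subproof q).

Lemma qform_map_isometric q r : isometric q r -> isometric (qform_map q) (qform_map r).
Proof.
move=> [P [Q [PQ QP E]]]; exists (map_mx h P), (map_mx h Q); rewrite /=.
by rewrite -!map_mxM PQ QP !map_mx1 map_trmx -!map_mxM E.
Qed.

Lemma isometric_eqmx n (A B : 'M[L]_n) hA hB :
  A = B -> isometric (@QForm L n A hA) (@QForm L n B hB).
Proof. by move=> E; exists 1%:M, 1%:M; rewrite /= !mul1mx trmx1 mulmx1. Qed.

Definition qcl_map (x : qclass K) : qclass L := qcl (qform_map (repr x)).

Lemma qcl_mapE q : qcl_map (qcl q) = qcl (qform_map q).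
Proof. exact/qclP/qform_map_isometric/repr_qcl. Qed.

Lemma qcl_map_nmod : nmod_morphism qcl_map.
Proof.
split=> [|x y].
  by rewrite -qcl_zero qcl_mapE; apply/qclP/isometric_eqmx; rewrite /= map_mx0.
have [[q ->] [r ->]] := conj (qclassP x) (qclassP y).
rewrite -qcl_sum !qcl_mapE -qcl_sum; apply/qclP/isometric_eqmx.
by rewrite /= map_block_mx !map_mx0.
Qed.

Lemma qcl_map_monoid : monoid_morphism qcl_map.
Proof.
split=> [|x y].
  by rewrite -qcl_one qcl_mapE; apply/qclP/isometric_eqmx; rewrite /= map_scalar_mx rmorph1.
have [[q ->] [r ->]] := conj (qclassP x) (qclassP y).
rewrite -qcl_tens !qcl_mapE -qcl_tens; apply/qclP/isometric_eqmx.
by rewrite /= map_mxT.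
Qed.

HB.instance Definition _ :=
  GRing.isNmodMorphism.Build (qclass K) (qclass L) qcl_map qcl_map_nmod.
HB.instance Definition _ :=
  GRing.isMonoidMorphism.Build (qclass K) (qclass L) qcl_map qcl_map_monoid.

Definition GWmap : GW K -> GW L := groth_lift (@ginj (qclass L) \o qcl_map).
HB.instance Definition _ := GRing.RMorphism.copy GWmap
  (groth_lift (@ginj (qclass L) \o qcl_map)).

Lemma GWmap_gwform q : GWmap (gwform q) = gwform (qform_map q).
Proof. by rewrite /GWmap /gwform groth_liftE raddf0 subr0 /= qcl_mapE. Qed.

Lemma unit_map_subproof (a : Kstar K) : h (sval a) != 0.
Proof. by rewrite fmorph_eq0 (svalP a). Qed.
Definition unit_map (a : Kstar K) : Kstar L :=
  exist _ (h (sval a)) (unit_map_subproof a).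

Lemma GWmap_gwdiag a : GWmap (gwdiag a) = gwdiag (unit_map a).
Proof.
rewrite GWmap_gwform; congr (ginj _); apply/qclP/isometric_eqmx.
by rewrite /= map_scalar_mx.
Qed.

Lemma GWmap_hypplane : GWmap (hypplane K) = hypplane L.
Proof.
rewrite /hypplane rmorphD /= !GWmap_gwdiag.
by congr (gwdiag _ + gwdiag _); apply: val_inj; rewrite /= ?rmorphN rmorph1.
Qed.

Lemma vdim_GWmap x : vdim (GWmap x) = vdim x.
Proof.
have [q [r ->]] := GWP x.
by rewrite [GWmap _]raddfB /= [LHS]raddfB [RHS]raddfB /= !GWmap_gwform !vdim_gwform.
Qed.

Definition Wmap (w : W K) : W L := wproj (GWmap (repr w)).

Lemma WmapE x : Wmap (wproj x) = wproj (GWmap x).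
Proof.
apply/eqP; rewrite /Wmap /wproj -Quotient.idealrBE -raddfB /=.
have : repr (wproj x) - x \in @hypideal K.
  by rewrite Quotient.idealrBE /wproj reprK.
move=> /asboolP[y ->]; apply/asboolP; exists (GWmap y).
by rewrite rmorphM /= GWmap_hypplane.
Qed.

Lemma Wmap_zmod : zmod_morphism Wmap.
Proof.
move=> x y; have [[a ->] [b ->]] := conj (WP x) (WP y).
rewrite -[_ - _ in LHS](raddfB (@wproj K)) !WmapE.
by rewrite (raddfB GWmap) (raddfB (@wproj L)).
Qed.

Lemma Wmap_monoid : monoid_morphism Wmap.
Proof.
split=> [|x y]; first by rewrite -(rmorph1 (@wproj K)) WmapE (rmorph1 GWmap) rmorph1.
have [[a ->] [b ->]] := conj (WP x) (WP y).
rewrite -(rmorphM (@wproj K)) !WmapE.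
by rewrite (rmorphM GWmap) (rmorphM (@wproj L)).
Qed.

HB.instance Definition _ := GRing.isZmodMorphism.Build (W K) (W L) Wmap Wmap_zmod.
HB.instance Definition _ := GRing.isMonoidMorphism.Build (W K) (W L) Wmap Wmap_monoid.

End ScalarExtension.

Definition ideal_mul (R : comPzRingType) (I J : {pred R}) : {pred R} := fun x =>
  `[< exists s : seq (R * R), (forall p, p \in s -> p.1 \in I /\ p.2 \in J) /\
        x = \sum_(p <- s) p.1 * p.2 >].

Fixpoint ideal_exp (R : comPzRingType) (I : {pred R}) (n : nat) : {pred R} :=
  if n is m.+1 then ideal_mul I (ideal_exp I m) else predT.

Lemma ideal_exp_zmod (R : comPzRingType) (I : zmodClosed R) n :
  zmod_closed (ideal_exp I n).
Proof.
case: n => [|n]; first by split.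
split; first by apply/asboolP; exists [::]; rewrite big_nil.
move=> x y /asboolP[s [Hs ->]] /asboolP[t [Ht ->]]; apply/asboolP.
exists (s ++ [seq (- p.1, p.2) | p <- t]); split.
  move=> p; rewrite mem_cat => /orP[/Hs //|/mapP[p' /Ht[h1 h2] ->]].
  by rewrite rpredN.
rewrite big_cat big_map /= -sumrN; congr (_ + _).
by apply: eq_bigr => p _; rewrite mulNr.
Qed.

(* The parity of the dimension is well defined on W(K), as hypplane K has     *)
(* dimension 2.                                                               *)
Definition fundI (K : fieldType) : {pred W K} :=
  fun w => `[< exists x : GW K, (2 %| vdim x)%Z /\ w = wproj x >].

Lemma fundI_zmod (K : fieldType) : zmod_closed (@fundI K).
Proof.
split; first by apply/asboolP; exists 0; rewrite !raddf0.
move=> u v /asboolP[x [Hx ->]] /asboolP[y [Hy ->]]; apply/asboolP.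
exists (x - y); split; last by rewrite raddfB.
by rewrite raddfB /=; apply: rpredB.
Qed.
HB.instance Definition _ (K : fieldType) :=
  GRing.isZmodClosed.Build (W K) (@fundI K) (@fundI_zmod K).

Definition Ipow_pred (K : fieldType) (n : nat) : {pred W K} := ideal_exp (@fundI K) n.
Arguments Ipow_pred : clear implicits.
HB.instance Definition _ (K : fieldType) n :=
  GRing.isZmodClosed.Build (W K) (Ipow_pred K n) (ideal_exp_zmod (@fundI K) n).

Record Ipow (K : fieldType) (n : nat) := MkIpow {
  Ipow_val :> W K; Ipow_valP : Ipow_val \in Ipow_pred K n }.
HB.instance Definition _ (K : fieldType) n := [isSub for @Ipow_val K n].
HB.instance Definition _ (K : fieldType) n := [Choice of Ipow K n by <:].
HB.instance Definition _ (K : fieldType) n :=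
  [SubChoice_isSubZmodule of Ipow K n by <:].

Lemma Wmap_Ipow (K L : fieldType) (h : {rmorphism K -> L}) n (w : W K) :
  w \in Ipow_pred K n -> Wmap h w \in Ipow_pred L n.
Proof.
elim: n w => [//|n IH] w /asboolP[s [Hs ->]]; apply/asboolP.
exists [seq (Wmap h p.1, Wmap h p.2) | p <- s]; split; last first.
  rewrite (raddf_sum (Wmap h)) big_map; apply: eq_bigr => p _.
  exact: (rmorphM (Wmap h)).
move=> _ /mapP[p /Hs[/asboolP[x [Hx E]] h2] ->]; split; last exact: IH.
by apply/asboolP; exists (GWmap h x); rewrite vdim_GWmap E WmapE.
Qed.

Definition Ipow_map (K L : fieldType) (h : {rmorphism K -> L}) n (q : Ipow K n) :
  Ipow L n := MkIpow (Wmap_Ipow h (Ipow_valP q)).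

(* The product is formed in GW(K), in the n-th power of the ideal of elements *)
(* of virtual dimension 0; wproj identifies that power with I^n(K).           *)
Definition pfister_val (K : fieldType) (s : seq (Kstar K)) : W K :=
  wproj (\prod_(a <- s) (1 - gwdiag a)).

Lemma pfister_subproof (K : fieldType) n (a : n.-tuple (Kstar K)) :
  pfister_val a \in Ipow_pred K n.
Proof.
case: a => s /= /eqP <-; elim: s => [//|a s IH].
rewrite /pfister_val big_cons (rmorphM (@wproj K)); apply/asboolP.
exists [:: (wproj (1 - gwdiag a), pfister_val s)]; split; last by rewrite big_seq1.
move=> p; rewrite inE => /eqP ->; split=> //; apply/asboolP.
by exists (1 - gwdiag a); rewrite raddfB /= rmorph1 vdim_gwform.
Qed.

Definition pfister (K : fieldType) n (a : n.-tuple (Kstar K)) : Ipow K n :=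
  MkIpow (pfister_subproof a).

Definition is_pfister (K : fieldType) n (x : Ipow K n) : Prop :=
  exists a : n.-tuple (Kstar K), x = pfister a.

Definition Pf (K : fieldType) (n : nat) := {x : Ipow K n | is_pfister x}.

(* An extension L/K of extensions of k is given by an element of fhom K L.    *)
(* Functor laws are stated up to pointwise equality of field morphisms.       *)
Record fext (k : fieldType) := FExt {
  fext_sort :> fieldType;
  fext_emb : {rmorphism k -> fext_sort} }.

Record fhom (k : fieldType) (K L : fext k) := FHom {
  fhom_fun :> {rmorphism K -> L};
  fhom_emb : forall x, fhom_fun (fext_emb K x) = fext_emb L x }.

Definition fbase (k : fieldType) : fext k := @FExt k k idfun.
Definition fstruct (k : fieldType) (K : fext k) : fhom (fbase k) K :=
  @FHom k (fbase k) K (fext_emb K) (fun=> erefl).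

Record filtRingFunctor (k : fieldType) := FiltRingFunctor {
  A_obj :> fext k -> comPzRingType;
  A_map : forall K L : fext k, fhom K L -> {rmorphism A_obj K -> A_obj L};
  A_map_id : forall (K : fext k) (h : fhom K K), h =1 id -> A_map h =1 id;
  A_map_comp : forall (K L P : fext k) (h : fhom K L) (h' : fhom L P) (h'' : fhom K P),
    h'' =1 h' \o h -> A_map h'' =1 A_map h' \o A_map h;
  A_fil : forall K : fext k, nat -> set (A_obj K);
  A_fil_full : forall (K : fext k) (x : A_obj K), A_fil 0 x;
  A_fil_decr : forall (K : fext k) d (x : A_obj K), A_fil d.+1 x -> A_fil d x;
  A_fil_zero : forall (K : fext k) d, A_fil d (0 : A_obj K);
  A_fil_sub : forall (K : fext k) d (x y : A_obj K),
    A_fil d x -> A_fil d y -> A_fil d (x - y);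
  A_fil_mul : forall (K : fext k) d e (x y : A_obj K),
    A_fil d x -> A_fil e y -> A_fil (d + e) (x * y);
  A_fil_map : forall (K L : fext k) (h : fhom K L) d (x : A_obj K),
    A_fil d x -> A_fil d (A_map h x) }.

(* A natural transformation Pf_n -> A on the category of extensions           *)
(* j : K -> L of K.                                                           *)
Record pfInv (k : fieldType) (A : filtRingFunctor k) (n : nat) (K : fext k) := PfInv {
  pfInv_fun :> forall L : fext k, fhom K L -> Pf L n -> A L;
  pfInv_nat : forall (L L' : fext k) (j : fhom K L) (j' : fhom K L') (h : fhom L L')
      (x : Pf L n) (x' : Pf L' n),
    j' =1 h \o j -> sval x' = Ipow_map h (sval x) ->
    pfInv_fun j' x' = A_map A h (pfInv_fun j x) }.

(* Nothing is required of f_0.  For n >= 1, f_n is determined by f_1 and      *)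
(* cf_f_pfister, since Pf_n(K) generates the group I^n(K); bundling it as     *)
(* data amounts to asserting its existence.                                   *)
Record coefFunctor (k : fieldType) := CoefFunctor {
  cf_functor :> filtRingFunctor k;
  cf_separated : forall (K : fext k) (x : cf_functor K),
    (forall d, A_fil d x) -> x = 0;
  cf_f : forall (n : nat) (K : fext k), {additive Ipow K n -> cf_functor K};
  cf_f_fil : forall n (K : fext k) (q : Ipow K n), (0 < n)%N -> A_fil n (cf_f n K q);
  cf_f1_nat : forall (K L : fext k) (h : fhom K L) (q : Ipow K 1),
    cf_f 1 L (Ipow_map h q) = A_map cf_functor h (cf_f 1 K q);
  cf_symb := fun (K : fext k) (s : seq (Kstar K)) =>
    \prod_(a <- s) cf_f 1 K (pfister [tuple a]);
  cf_symb_inj : forall n (K : fext k) (a b : n.-tuple (Kstar K)),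
    pfister a = pfister b <-> cf_symb a = cf_symb b;
  cf_f_pfister : forall n (K : fext k) (a : n.-tuple (Kstar K)), (0 < n)%N ->
    cf_f n K (pfister a) = cf_symb a;
  cf_descent : forall d (K : fext k) (x : cf_functor K),
    (forall (L : fext k) (h : fhom K L) (a : Kstar L),
       A_fil d.+1 (cf_symb [:: a] * A_map cf_functor h x)) -> A_fil d x;
  cf_pfInv : forall n (K : fext k), (0 < n)%N -> forall phi : pfInv cf_functor n K,
    exists! xy : cf_functor K * cf_functor K,
      forall (L : fext k) (j : fhom K L) (x : Pf L n),
        phi L j x = A_map cf_functor j xy.1 + A_map cf_functor j xy.2 * cf_f n L (sval x) }.

(* M = Inv(I^n, A).  It lives in a universe too large for the algebraic       *)
(* structures of the library, so its A(k)-module operations are given as      *)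
(* plain functions.                                                           *)
Record InvI (k : fieldType) (A : coefFunctor k) (n : nat) := MkInvI {
  Inv_fun :> forall K : fext k, Ipow K n -> A K;
  Inv_nat : forall (K L : fext k) (h : fhom K L) (q : Ipow K n),
    @Inv_fun L (Ipow_map h q) = A_map A h (@Inv_fun K q) }.

Section Invariants.
Variables (k : fieldType) (A : coefFunctor k) (n : nat).
Implicit Types alpha beta : InvI A n.

Lemma Inv_ext alpha beta : (forall K q, alpha K q = beta K q) -> alpha = beta.
Proof.
case: alpha beta => [a aP] [b bP] /= E.
have {}E : a = b by apply/functional_extensionality_dep => K; apply/funext => q.
by move: E aP bP => -> aP bP; congr MkInvI; exact: Prop_irrelevance.
Qed.

Definition scalars := A (fbase k).

Lemma Inv_add_nat alpha beta (K L : fext k) (h : fhom K L) (q : Ipow K n) :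
  alpha L (Ipow_map h q) + beta L (Ipow_map h q) = A_map A h (alpha K q + beta K q).
Proof. by rewrite rmorphD !Inv_nat. Qed.
Definition Inv_add alpha beta : InvI A n := MkInvI (Inv_add_nat alpha beta).

Lemma Inv_scale_nat (c : scalars) alpha (K L : fext k) (h : fhom K L) (q : Ipow K n) :
  A_map A (fstruct L) c * alpha L (Ipow_map h q) =
  A_map A h (A_map A (fstruct K) c * alpha K q).
Proof.
rewrite rmorphM Inv_nat; congr (_ * _); apply: A_map_comp => x.
exact/esym/fhom_emb.
Qed.
Definition Inv_scale (c : scalars) alpha : InvI A n := MkInvI (Inv_scale_nat c alpha).

Definition Inv_fil (m : nat) alpha : Prop :=
  forall (K : fext k) (q : Ipow K n), A_fil m (alpha K q).

(* The filtered module N; truncated subtraction accounts for A^j(k) = A(k)    *)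
(* when j <= 0.                                                               *)
Definition seqmod := nat -> (scalars : comPzRingType)^o.
Definition seqmod_fil (m : nat) (a : seqmod) : Prop :=
  forall d, A_fil (m - n * d) (a d : A (fbase k)).

(* Characterizes the operator P : alpha |-> alpha^eps, for eps = 1 or -1.     *)
Definition is_Phi (eps : int) (P : InvI A n -> InvI A n) : Prop :=
  forall alpha (K : fext k) (q phi : Ipow K n), is_pfister phi ->
    alpha K (q + phi *~ eps) = alpha K q + (cf_f A n K phi * P alpha K q) *~ eps.

Definition Inv_at0 alpha : scalars := alpha (fbase k) 0.

Record is_g (Phip Phim : InvI A n -> InvI A n) (g : nat -> InvI A n) : Prop := IsG {
  g_fil : forall d, Inv_fil (n * d) (g d);
  g_0 : forall (K : fext k) (q : Ipow K n), g 0%N K q = 1;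
  g_at0 : forall d, Inv_at0 (g d.+1) = 0;
  g_even : forall d, ~~ odd d -> Phim (g d.+1) = g d;
  g_odd : forall d, odd d -> Phip (g d.+1) = g d }.

(* alpha^[d]: Phip is applied s times if d = 2s and s + 1 times if d = 2s + 1,*)
(* and Phim is applied s times.                                               *)
Definition Inv_br (Phip Phim : InvI A n -> InvI A n) (d : nat) alpha : InvI A n :=
  iter (uphalf d) Phip (iter d./2 Phim alpha).

Record mutually_inverse_filtered_isos (F : seqmod -> InvI A n) (G : InvI A n -> seqmod)
    : Prop := FilteredIsos {
  F_linear : forall (c : scalars) (a b : seqmod),
    F (c *: a + b) = Inv_add (Inv_scale c (F a)) (F b);
  G_linear : forall (c : scalars) alpha beta,
    G (Inv_add (Inv_scale c alpha) beta) = c *: G alpha + G beta;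
  FK : cancel F G;
  GK : cancel G F;
  F_fil : forall m a, seqmod_fil m a -> Inv_fil m (F a);
  G_fil : forall m alpha, Inv_fil m alpha -> seqmod_fil m (G alpha) }.

End Invariants.

(* Main.v *)
Require Import Defs.
From mathcomp Require Import all_boot all_order all_algebra.
From mathcomp Require Import boolp classical_sets functions cardinality fsbigop.
Set Implicit Arguments.
Unset Strict Implicit.
Unset Printing Implicit Defensive.
Import GRing.Theory.
Local Open Scope ring_scope.

(** Write E for {-1}^n in A(k), f for f_n, and + and - for the two operators;
    F and G are g_sum and Inv_jet.

    In characteristic different from 2 every form is diagonal, so the group
    I^n(K) is generated by n-fold Pfister elements (Ipow_ind).  Hence an
    invariant alpha is controlled by alpha(0) and by its differences
    alpha(q + phi) - alpha(q) = f(phi) alpha^+(q) and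
    alpha(q) - alpha(q - phi) = f(phi) alpha^-(q) for phi Pfister.  Since x + y f
    determines x and y, f(phi) may be cancelled when phi ranges over all
    extensions (cf_f_regular, Inv_eqP).  Comparing alpha at q and at
    (q + phi) - phi, with f(phi)^2 = E f(phi), gives
    alpha^+ = alpha^- + E alpha^{+-} (Phi_sub), and computing
    alpha(q + phi - psi) in two ways gives alpha^{+-} = alpha^{-+} (PhiC).

    On the g_d these relations yield g_d^+ and g_d^- as explicit combinations of
    g_{d-1} and g_{d-2} (Phip_g, Phim_g).  So adding or subtracting one Pfister
    element raises by at most 2 the degree beyond which the g_d vanish
    (g_vanish), and the operators act on sums of a_d g_d through two explicit
    operators on sequences, whose composite is the shift a_d |-> a_{d+2}
    (Phip_g_sum, Phim_g_sum, shift_pm).  Reading off values at 0 gives G F = id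
    (Inv_jet_g_sum).

    For F G = id it suffices that G is injective.  Its kernel is stable under
    + and - by Phi_sub, and each of its members vanishes at 0; as f(phi) lies in
    A^n with n >= 1, induction on m puts the kernel in M^m for every m
    (Inv_jet0_fil), hence it is 0 because the filtration is separated.

    F is filtered because g_d has values in A^{nd}.  G is filtered because each
    operator sends M^m to M^{m-n}: f(phi) alpha^+(q) lies in A^m over every
    extension, and the descent axiom removes the n slots of the symbol one at a
    time (symb_descent). *)

(** * Diagonalization, and generation of I^n by Pfister elements *)

Section Diagonalization.
Variable K : fieldType.
Hypothesis two_neq0 : (2 : K) != 0.

Lemma congruent_isometric m (M N P : 'M[K]_m) hM hN :
  P \in unitmx -> M = P *m N *m P^T -> isometric (@QForm K m M hM) (@QForm K m N hN).
Proof. by move=> uP E; exists P, (invmx P); split; rewrite /= ?mulmxV ?mulVmx. Qed.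

Lemma quad_polar m (M : 'M[K]_m) (u v : 'rV[K]_m) : M^T = M ->
  (u + v) *m M *m (u + v)^T =
  u *m M *m u^T + v *m M *m v^T + (u *m M *m v^T) *+ 2.
Proof.
move=> sM; have sw : v *m M *m u^T = u *m M *m v^T.
  have tr11 (X : 'M[K]_1) : X = X^T by apply/matrixP=> i j; rewrite mxE !ord1.
  by rewrite [RHS]tr11 !trmx_mul trmxK sM mulmxA.
rewrite [(u + v)^T]raddfD /= !(mulmxDl, mulmxDr) sw mulr2n.
by rewrite -!addrA; congr (_ + _); rewrite [RHS]addrC -addrA.
Qed.

Lemma anisotropic_vector m (M : 'M[K]_m) : M^T = M -> M != 0 ->
  exists v : 'rV[K]_m, v *m M *m v^T != 0.
Proof.
move=> sM /eqP nM; apply: contrapT => H; apply: nM.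
have H0 (v : 'rV[K]_m) : v *m M *m v^T = 0 by apply/eqP/negbNE/negP => nv; apply: H; exists v.
apply/matrixP=> i j; rewrite mxE.
have := quad_polar (delta_mx 0 i) (delta_mx 0 j) sM.
rewrite !H0 !add0r -rowE trmx_delta -colE => /matrixP/(_ 0 0)/eqP.
rewrite mulmxnE !mxE eq_sym -mulr_natl mulf_eq0 (negbTE two_neq0) /=.
by move/eqP.
Qed.

(** A vector v with b(v, v) <> 0 is, up to a scalar, the first row of the
    invertible matrix row_ebase v; in the corresponding basis the upper left
    entry is nonzero and block elimination splits off a line. *)
Lemma gwform_diag (q : qform K) : exists s : seq (Kstar K), gwform q = \sum_(a <- s) gwdiag a.
Proof.
case: q; elim=> [|m IH] M hM.
  exists [::]; rewrite big_nil -[RHS](raddf0 (@ginj (qclass K))) -qcl_zero.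
  congr ginj; apply/qclP; apply: (@congruent_isometric 0 M 0 1%:M); rewrite ?unitmx1 //.
  by rewrite !flatmx0.
have /andP[/eqP sM uM] := hM.
have nM : M != 0.
  by apply: contraTneq uM => ->; rewrite unitmxE det0 unitr0.
have [v nv] := anisotropic_vector sM nM.
have nv0 : v != 0 by apply: contraNneq nv => ->; rewrite !mul0mx.
pose P : 'M[K]_(1 + m) := row_ebase v; have uP : P \in unitmx by exact: row_ebase_unit.
pose N : 'M[K]_(1 + m) := P *m M *m P^T.
have sN : N^T = N by rewrite /N !trmx_mul trmxK sM mulmxA.
have uN : N \in unitmx by rewrite /N !unitmx_mul unitmx_tr uP andbT; exact: uM.
have eN := submxK N; set a := ulsubmx N in eN; set b := ursubmx N in eN.
set D := drsubmx N in eN.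
have eb : dlsubmx N = b^T by rewrite /b trmx_ursub sN.
rewrite eb in eN.
have na : a 0 0 != 0.
  apply: contra_neq nv => a0.
  have {}a0 : a = 0 by rewrite [a]mx11_scalar a0 raddf0.
  pose c := col_ebase v *m (pid_mx (\rank v) : 'M_(1, 1 + m)).
  have Ev : v = c *m P by rewrite /c mulmx_ebase.
  have Ec : c = row_mx (c 0 0)%:M 0.
    rewrite -[LHS]hsubmxK; congr row_mx.
      by rewrite [lsubmx c]mx11_scalar mxE (_ : lshift m 0 = 0) //; apply: val_inj.
    rewrite /c rank_rV nv0 /= [col_ebase v]mx11_scalar mul_scalar_mx.
    by apply/matrixP=> i j; rewrite !mxE /= ord1 /= mulr0.
  have -> : v *m M *m v^T = c *m N *m c^T.
    by rewrite {1 2}Ev /N trmx_mul !mulmxA.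
  rewrite -eN Ec tr_row_mx tr_scalar_mx trmx0 mul_row_block mul_row_col a0.
  by rewrite !(mulmx0, mul0mx, addr0, add0r).

(* T is the Schur complement of the upper left entry t. *)
pose t := a 0 0; pose T : 'M[K]_m := D - t^-1 *: (b^T *m b).
pose L : 'M[K]_(1 + m) := block_mx 1%:M 0 (t^-1 *: b^T) 1%:M.
have uL : L \in unitmx by rewrite unitmxE det_lblock !det1 mulr1 unitr1.
have NE : N = L *m block_mx t%:M 0 0 T *m L^T.
  rewrite -eN [a]mx11_scalar -/t tr_block_mx !trmx1 trmx0 mulmx_block.
  rewrite !(mulmx0, mul0mx, mul1mx, mulmx1, addr0, add0r) mulmx_block.
  rewrite !(mulmx0, mul0mx, mul1mx, mulmx1, addr0, add0r) [(_ *: _)^T]linearZ /= trmxK.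
  rewrite mul_mx_scalar mul_scalar_mx !scalerA mulfV // !scale1r.
  by rewrite -scalemxAr /T addrC subrK.
have hT : (T^T == T) && (T \in unitmx).
  apply/andP; split.
    rewrite /T [(D - _)^T]raddfB /= [(_ *: _)^T]linearZ /= trmx_mul trmxK.
    by rewrite /D trmx_drsub sN.
  have := uN; rewrite NE !unitmx_mul => /andP[/andP[_ +] _].
  by rewrite !unitmxE det_ublock unitrM => /andP[].
pose c : Kstar K := exist _ t na.
have [s Es] := IH T hT; exists (c :: s); rewrite big_cons -Es /gwdiag /gwform.
rewrite -raddfD -qcl_sum /=; congr ginj; apply/qclP.
apply: (@congruent_isometric (1 + m) M (block_mx t%:M 0 0 T) (invmx P *m L) hM
         (qsum_subproof (qdiag1 c) (QForm hT))).
  by rewrite unitmx_mul unitmx_inv uP.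
rewrite trmx_mul !mulmxA -(mulmxA (invmx P)) -(mulmxA (invmx P)) -NE /N.
by rewrite !mulmxA mulVmx // mul1mx -mulmxA -trmx_mul mulVmx // trmx1 mulmx1.
Qed.

Lemma gwdiag1 : gwdiag (unit1 K) = 1 :> GW K.
Proof. exact: (rmorph1 (@ginj (qclass K))). Qed.

Lemma wproj_gwdiagN1 : wproj (gwdiag (unitN1 K)) = -1.
Proof.
have : wproj (hypplane K) == wproj 0.
  rewrite /wproj -Quotient.idealrBE subr0.
  by apply/asboolP; exists 1; rewrite mul1r.
rewrite (rmorph0 (@wproj K)) (rmorphD (@wproj K)) /= gwdiag1 (rmorph1 (@wproj K)).
by rewrite addrC addr_eq0 => /eqP.
Qed.

Lemma wprojB (x y : GW K) : wproj (x - y) = wproj x - wproj y.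
Proof. exact: (raddfB (@wproj K)). Qed.

Lemma wproj1B (x : GW K) : wproj (1 - x) = 1 - wproj x.
Proof. by rewrite wprojB; congr (_ - _); exact: (rmorph1 (@wproj K)). Qed.

Lemma gwdiag_sqr (a : Kstar K) : gwdiag a * gwdiag a = 1.
Proof.
rewrite -gwdiag1 /gwdiag /gwform -rmorphM -qcl_tens; congr ginj; apply/qclP.
have ua : (sval a)%:M \in @unitmx K 1.
  by rewrite unitmxE det_scalar unitfE expf_neq0 ?(svalP a).
apply: (@congruent_isometric 1 _ _ (sval a)%:M _ _ ua).
apply/matrixP=> i j; rewrite tr_scalar_mx mulmx1 -scalar_mxM !mxE.
by rewrite !ord1 !eqxx.
Qed.

Section Span.
Variable S : W K -> Prop.
Hypotheses (S0 : S 0) (SB : forall x y, S x -> S y -> S (x - y)).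

Lemma span_sum (I : eqType) (s : seq I) (F : I -> W K) :
  (forall i, i \in s -> S (F i)) -> S (\sum_(i <- s) F i).
Proof.
move=> HS; rewrite big_seq; apply: (big_ind S) => // x y Sx Sy.
by rewrite -[y]opprK -[- y]sub0r; apply: SB Sx (SB S0 Sy).
Qed.

(** If an even-dimensional class is the sum of the <a>, a in s, minus the sum of
    the <b>, b in t, its image in W(K) is the sum of the 1 - <b> minus the sum of
    the 1 - <a>, plus the even integer size s - size t; and 2 = 1 - <-1>
    in W(K). *)
Lemma fundI_span (w : W K) :
  (forall a : Kstar K, S (wproj (1 - gwdiag a))) -> w \in @fundI K -> S w.
Proof.
move=> Sdiag /asboolP[x [dx ->]].
have [q [r Ex]] := GWP x; have [[s Es] [t Et]] := conj (gwform_diag q) (gwform_diag r).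
have dimE (u : seq (Kstar K)) : vdim (\sum_(a <- u) gwdiag a) = (size u)%:Z.
  rewrite raddf_sum /= (eq_bigr (fun=> 1)) => [|a _]; last by rewrite vdim_gwform.
  by rewrite big_const_seq count_predT iter_addr_0 /= natz.
have sumE (u : seq (Kstar K)) :
    wproj (\sum_(a <- u) gwdiag a) = (size u)%:R - \sum_(a <- u) wproj (1 - gwdiag a).
  apply/eqP; rewrite eq_sym subr_eq raddf_sum -big_split /=.
  rewrite (eq_bigr (fun=> 1)) => [|a _]; last first.
    by rewrite wproj1B addrC subrK.
  by rewrite big_const_seq count_predT iter_addr_0.
have Ssum (u : seq (Kstar K)) : S (\sum_(a <- u) wproj (1 - gwdiag a)).
  by apply: span_sum.
have /dvdzP[m Em] : (2 %| (size s)%:Z - (size t)%:Z)%Z.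
  by move: dx; rewrite Ex Es Et raddfB /= !dimE.
have SD u v : S u -> S v -> S (u + v).
  by move=> Su Sv; rewrite -[v]opprK -[- v]sub0r; apply: SB Su (SB S0 Sv).
have S2 : S 2.
  by have := Sdiag (unitN1 K); rewrite wproj1B wproj_gwdiagN1 opprK.
have Sm (i : int) : S (2 *~ i).
  have Sn (j : nat) : S (2 *+ j) by elim: j => // j IHj; rewrite mulrS; apply: SD.
  by case: i => j; [exact: Sn | rewrite NegzE mulrNz -sub0r; apply: SB (Sn _)].
rewrite Ex Es Et wprojB !sumE opprB [X in _ + X]addrC addrACA; apply: SD => //.
  have -> : (size s)%:R - (size t)%:R = ((size s)%:Z - (size t)%:Z)%:~R :> W K.
    by rewrite intrB.
  by rewrite Em mulrC intrM mulrzr; exact: Sm.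
by rewrite addrC; apply: SB.
Qed.
End Span.

(** The virtual dimension is multiplicative. *)
Lemma fundI_mulr (x y : W K) : x \in @fundI K -> x * y \in @fundI K.
Proof.
move=> /asboolP[u [du ->]]; have [v ->] := WP y; apply/asboolP; exists (u * v).
by rewrite (rmorphM (@wproj K)) (rmorphM (@vdim K)) dvdz_mulr.
Qed.

Lemma pfister_val_cons (a : Kstar K) s :
  pfister_val (a :: s) = wproj (1 - gwdiag a) * pfister_val s.
Proof. by rewrite /pfister_val big_cons (rmorphM (@wproj K)). Qed.

Lemma Ipow_span n (S : W K -> Prop) (w : W K) :
  S 0 -> (forall x y, S x -> S y -> S (x - y)) ->
  (forall a : n.+1.-tuple (Kstar K), S (pfister_val a)) ->
  w \in Ipow_pred K n.+1 -> S w.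
Proof.
elim: n S w => [|n IH] S w S0 SB Spf /asboolP[s [Hs ->]].
  apply: span_sum => // p /Hs[p1 _].
  apply: (fundI_span S0 SB) (fundI_mulr _ p1) => a.
  have := Spf [tuple a].
  by rewrite pfister_val_cons /pfister_val big_nil (rmorph1 (@wproj K)) mulr1.
apply: span_sum => // p /Hs[p1 p2].
apply: (fundI_span (S := fun x => S (x * p.2))) p1 => [|x y Sx Sy|a].
- by rewrite mul0r.
- by rewrite mulrBl; apply: SB.
apply: (IH (fun y => S (wproj (1 - gwdiag a) * y))) p2 => [|x y Sx Sy|b].
- by rewrite mulr0.
- by rewrite mulrBr; apply: SB.
by rewrite -pfister_val_cons; exact: (Spf [tuple of a :: b]).
Qed.

(** The predicate is propagated along translations: those w such that P is stable
    under adding and subtracting w form a group, which contains the Pfister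
    elements. *)
Lemma Ipow_ind n (P : Ipow K n -> Prop) : (0 < n)%N -> P 0 ->
  (forall q phi, is_pfister phi -> P q -> P (q + phi)) ->
  (forall q phi, is_pfister phi -> P q -> P (q - phi)) -> forall q, P q.
Proof.
case: n P => // n P _ P0 PD PB q.
pose S w := exists2 v : Ipow K n.+1, val v = w &
  forall r, P r -> P (r + v) /\ P (r - v).
have [v] : S (val q).
  apply: (@Ipow_span n S) (valP q) => [|x y [u <- Pu] [v <- Pv]|a].
  - exists 0 => [|r Pr]; first exact: raddf0.
    by rewrite subr0 addr0.
  - exists (u - v); first exact: raddfB.
    move=> r Pr; rewrite opprB !addrA; split.
      exact: proj2 (Pv _ (proj1 (Pu r Pr))).
    exact: proj2 (Pu _ (proj1 (Pv r Pr))).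
  - exists (pfister a) => // r Pr.
    by split; [apply: PD | apply: PB] => //; exists a.
by move=> /val_inj -> /(_ 0 P0)[]; rewrite add0r.
Qed.

End Diagonalization.

(** * Symbols and their multiplicative relations *)

Section ScalarExtensionOfPfister.
Variables (K L : fieldType) (h : {rmorphism K -> L}).

Lemma Ipow_map_pfister1 (a : Kstar K) :
  Ipow_map h (pfister [tuple a]) = pfister [tuple unit_map h a].
Proof.
apply: val_inj; rewrite /= /pfister_val !big_seq1 WmapE.
congr wproj; rewrite -GWmap_gwdiag -(rmorph1 (GWmap h)).
exact: (raddfB (GWmap h)).
Qed.

Lemma Ipow_map0 n : Ipow_map h 0 = 0 :> Ipow L n.
Proof. by apply: val_inj; exact: (raddf0 (Wmap h)). Qed.

Lemma unit_mapN1 : unit_map h (unitN1 K) = unitN1 L.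
Proof. by apply: val_inj; rewrite /= rmorphN1. Qed.
End ScalarExtensionOfPfister.

(** (1 - <a>)^2 = 2 (1 - <a>) because <a>^2 = 1. *)
Lemma pfister_sqr (K : fieldType) (a : Kstar K) :
  pfister [tuple a; a] = pfister [tuple a; unitN1 K].
Proof.
apply: val_inj; rewrite /= !pfister_val_cons !(wproj1B, wproj_gwdiagN1) opprK.
rewrite !mulrA; congr (_ * _).
rewrite mulrBr mulr1 mulrBl mul1r mulrDr mulr1 opprB; congr (_ + _).
rewrite -[_ * _](rmorphM (@wproj K)) gwdiag_sqr.
by congr (_ - _); exact: (rmorph1 (@wproj K)).
Qed.

(** * Consequences of the axioms on A *)

Definition fhom_id (k : fieldType) (K : fext k) : fhom K K :=
  @FHom k K K idfun (fun=> erefl).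

Lemma fhom_comp_subproof (k : fieldType) (K L P : fext k) (h : fhom K L)
    (h' : fhom L P) x :
  (h' \o h : {rmorphism K -> P}) (fext_emb K x) = fext_emb P x.
Proof. by rewrite /= !fhom_emb. Qed.
Definition fhom_comp (k : fieldType) (K L P : fext k) (h : fhom K L)
  (h' : fhom L P) : fhom K P := FHom (fhom_comp_subproof h h').

Section Coefficients.
Variables (k : fieldType) (A : coefFunctor k).

Lemma A_fil_le (K : fext k) d e (x : A K) : (d <= e)%N -> A_fil e x -> A_fil d x.
Proof.
move=> /subnK <-; elim: (e - d)%N => // i IH; rewrite addSn => /A_fil_decr.
exact: IH.
Qed.

Lemma A_fil_add (K : fext k) d (x y : A K) : A_fil d x -> A_fil d y -> A_fil d (x + y).
Proof.
move=> fx fy; rewrite -[y]opprK -[- y]sub0r.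
by apply: A_fil_sub => //; apply: A_fil_sub => //; exact: A_fil_zero.
Qed.

Lemma A_fil_sum (K : fext k) d (I : Type) (s : seq I) (x : I -> A K) :
  (forall i, A_fil d (x i)) -> A_fil d (\sum_(i <- s) x i).
Proof.
by move=> fx; apply: big_ind => //; [exact: A_fil_zero | exact: A_fil_add].
Qed.

Lemma cf_symb_cons (K : fext k) (a : Kstar K) s :
  cf_symb A (a :: s) = cf_symb A [:: a] * cf_symb A s.
Proof. by rewrite /cf_symb big_cons big_seq1. Qed.

Lemma cf_symb1_map (K L : fext k) (h : fhom K L) (a : Kstar K) :
  A_map A h (cf_symb A [:: a]) = cf_symb A [:: unit_map h a].
Proof. by rewrite /cf_symb !big_seq1 -cf_f1_nat Ipow_map_pfister1. Qed.

Lemma cf_symb_map (K L : fext k) (h : fhom K L) (s : seq (Kstar K)) :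
  A_map A h (cf_symb A s) = cf_symb A (map (unit_map h) s).
Proof.
elim: s => [|a s IH]; first by rewrite /cf_symb !big_nil rmorph1.
by rewrite cf_symb_cons rmorphM cf_symb1_map IH [RHS]cf_symb_cons.
Qed.

(** {a}{a} = {a}{-1} by pfister_sqr, since symbols only depend on the Pfister
    element. *)
Lemma cf_symb_sqr (K : fext k) (s : seq (Kstar K)) :
  cf_symb A s * cf_symb A s = cf_symb A [:: unitN1 K] ^+ size s * cf_symb A s.
Proof.
elim: s => [|a s IH]; first by rewrite expr0 /cf_symb big_nil.
have sqr : cf_symb A [:: a] * cf_symb A [:: a]
    = cf_symb A [:: a] * cf_symb A [:: unitN1 K].
  rewrite -!cf_symb_cons.
  exact: (proj1 (cf_symb_inj A [tuple a; a] [tuple a; unitN1 K]) (pfister_sqr a)).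
by rewrite cf_symb_cons mulrACA IH sqr exprS [cf_symb A [:: a] * _]mulrC mulrACA.
Qed.

(** The descent axiom iterated: for a fixed slot a, the element {a} x satisfies
    the hypothesis with one slot less. *)
Lemma symb_descent r d (K : fext k) (x : A K) :
  (forall (L : fext k) (h : fhom K L) (s : r.-tuple (Kstar L)),
     A_fil d (cf_symb A s * A_map A h x)) ->
  A_fil (d - r) x.
Proof.
elim: r K x => [|r IH] K x H.
  have := H K (fhom_id K) [tuple]; rewrite /cf_symb big_nil mul1r subn0.
  by rewrite A_map_id.
case: (leqP d r.+1) => [|lt_r_d].
  by rewrite -subn_eq0 => /eqP ->; exact: A_fil_full.
apply: cf_descent => L h a; rewrite subnSK; last exact: ltnW.
apply: IH => P h' s; rewrite rmorphM cf_symb1_map mulrA [cf_symb A s * _]mulrC.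
have <- : A_map A (fhom_comp h h') x = A_map A h' (A_map A h x) by exact: A_map_comp.
by rewrite -cf_symb_cons; exact: (H P (fhom_comp h h') [tuple of _ :: s]).
Qed.

Variable n : nat.
Hypothesis n_gt0 : (0 < n)%N.

(** The zero invariant of Pf_n over K is both 0 + 0 f and 0 + x f. *)
Lemma cf_f_regular (K : fext k) (x : A K) :
  (forall (L : fext k) (j : fhom K L) (phi : Ipow L n), is_pfister phi ->
     cf_f A n L phi * A_map A j x = 0) -> x = 0.
Proof.
move=> H.
pose zero : pfInv A n K := @PfInv k A n K (fun _ _ _ => 0)
  (fun _ _ _ _ h _ _ _ _ => esym (rmorph0 (A_map A h))).
have [xy [_ uniq]] := cf_pfInv n_gt0 zero.
have E0 : xy = (0, 0) by apply: uniq => L j q; rewrite /= !rmorph0 mul0r addr0.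
have Ex : xy = (0, x).
  apply: uniq => L j q; rewrite /= rmorph0 add0r mulrC H //; exact: (svalP q).
by move: Ex; rewrite E0 => -[].
Qed.

(** The element {-1}^n, for which f(phi)^2 = {-1}^n f(phi) on Pfister elements. *)
Definition eps : scalars A := cf_symb A [:: unitN1 k : Kstar (fbase k)] ^+ n.

Lemma eps_map (K : fext k) :
  A_map A (fstruct K) eps = cf_symb A [:: unitN1 K] ^+ n.
Proof.
by rewrite rmorphXn /= cf_symb1_map (unit_mapN1 (fstruct K)).
Qed.

Lemma cf_f_sqr (K : fext k) (phi : Ipow K n) : is_pfister phi ->
  cf_f A n K phi * cf_f A n K phi = A_map A (fstruct K) eps * cf_f A n K phi.
Proof.
move=> [a ->]; rewrite cf_f_pfister // cf_symb_sqr eps_map; congr (_ ^+ _ * _).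
exact: size_tuple.
Qed.

Lemma Inv_eqP (alpha beta : InvI A n) :
  (forall (K : fext k) (q phi : Ipow K n), is_pfister phi ->
     cf_f A n K phi * alpha K q = cf_f A n K phi * beta K q) -> alpha = beta.
Proof.
move=> H; apply: Inv_ext => K q; apply/eqP; rewrite -subr_eq0; apply/eqP.
apply: cf_f_regular => L j phi Pphi.
by rewrite rmorphB -!Inv_nat mulrBr H // subrr.
Qed.

Lemma Inv_val0 (alpha : InvI A n) (K : fext k) :
  alpha K 0 = A_map A (fstruct K) (Inv_at0 alpha).
Proof. by rewrite /Inv_at0 -Inv_nat Ipow_map0. Qed.

End Coefficients.

(** * The operators + and - *)

Section Operators.
Variables (k : fieldType) (A : coefFunctor k) (n : nat).
Hypothesis n_gt0 : (0 < n)%N.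
Variables Phip Phim : InvI A n -> InvI A n.
Hypotheses (hPhip : is_Phi 1 Phip) (hPhim : is_Phi (-1) Phim).
Implicit Types alpha beta : InvI A n.

Local Notation E K := (A_map A (fstruct K) (eps A n)).

Lemma PhipE alpha (K : fext k) (q phi : Ipow K n) : is_pfister phi ->
  alpha K (q + phi) = alpha K q + cf_f A n K phi * Phip alpha K q.
Proof. exact: hPhip. Qed.

Lemma PhimE alpha (K : fext k) (q phi : Ipow K n) : is_pfister phi ->
  alpha K (q - phi) = alpha K q - cf_f A n K phi * Phim alpha K q.
Proof. exact: hPhim. Qed.

Lemma Phip_unique alpha beta :
  (forall (K : fext k) (q phi : Ipow K n), is_pfister phi ->
     alpha K (q + phi) = alpha K q + cf_f A n K phi * beta K q) -> Phip alpha = beta.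
Proof.
move=> H; apply: Inv_eqP => // K q phi Pphi.
by apply: (addrI (alpha K q)); rewrite -H // PhipE.
Qed.

Lemma Phim_unique alpha beta :
  (forall (K : fext k) (q phi : Ipow K n), is_pfister phi ->
     alpha K (q - phi) = alpha K q - cf_f A n K phi * beta K q) -> Phim alpha = beta.
Proof.
move=> H; apply: Inv_eqP => // K q phi Pphi.
by apply/oppr_inj/(addrI (alpha K q)); rewrite -H // PhimE.
Qed.

Lemma Phip_lin (c : scalars A) alpha beta :
  Phip (Inv_add (Inv_scale c alpha) beta) = Inv_add (Inv_scale c (Phip alpha)) (Phip beta).
Proof.
apply: Phip_unique => K q phi Pphi; rewrite /= !PhipE //.
by rewrite !mulrDr addrACA mulrCA.
Qed.

Lemma Phim_lin (c : scalars A) alpha beta :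
  Phim (Inv_add (Inv_scale c alpha) beta) = Inv_add (Inv_scale c (Phim alpha)) (Phim beta).
Proof.
apply: Phim_unique => K q phi Pphi; rewrite /= !PhimE //.
by rewrite mulrBr mulrDr opprD addrACA mulrCA.
Qed.

(** Expanding alpha(q + phi - psi) in both orders shows that the two composites
    agree after multiplication by f(phi) f(psi).  Both factors are then cancelled
    in turn, the second after an arbitrary extension, which is why phi has to be
    moved to that extension. *)
Lemma PhiC alpha : Phip (Phim alpha) = Phim (Phip alpha).
Proof.
have mixed (K : fext k) (q phi psi : Ipow K n) : is_pfister phi -> is_pfister psi ->
    cf_f A n K psi * (cf_f A n K phi * Phip (Phim alpha) K q) =
    cf_f A n K psi * (cf_f A n K phi * Phim (Phip alpha) K q).
  move=> Pphi Ppsi; have := PhipE alpha (q - psi) Pphi.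
  rewrite addrAC !PhimE // !PhipE // mulrDr mulrBr opprD !addrA.
  rewrite [_ - _ + cf_f A n K phi * _]addrAC => /addrI/oppr_inj ->.
  by rewrite mulrCA.
apply: Inv_eqP => // K q phi [a ->]; apply/eqP; rewrite -subr_eq0 -mulrBr; apply/eqP.
apply: (cf_f_regular n_gt0) => L j psi Ppsi.
rewrite rmorphM /= ?cf_f_pfister // cf_symb_map.
rewrite -(cf_f_pfister A (map_tuple (unit_map j) a)) //.
rewrite rmorphB -!Inv_nat !mulrBr mixed ?subrr //.
by exists (map_tuple (unit_map j) a).
Qed.

(** This is alpha(q) = alpha((q + phi) - phi), expanded and divided by f(phi). *)
Lemma Phi_sub alpha (K : fext k) (q : Ipow K n) :
  Phip alpha K q = Phim alpha K q + E K * Phip (Phim alpha) K q.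
Proof.
suff -> : Phip alpha = Inv_add (Inv_scale (eps A n) (Phip (Phim alpha))) (Phim alpha).
  by rewrite /= addrC.
apply: Inv_eqP => // {}K {}q phi Pphi; rewrite /= mulrDr mulrA [_ * E K]mulrC.
rewrite -cf_f_sqr // -mulrA -mulrDr.
have := PhimE alpha (q + phi) Pphi; rewrite addrK !PhipE // => /eqP.
by rewrite -addrA -[X in X == _]addr0 (inj_eq (addrI _)) eq_sym subr_eq0 addrC => /eqP.
Qed.

Lemma Inv_brSS d alpha : Inv_br Phip Phim d.+2 alpha = Inv_br Phip Phim d (Phip (Phim alpha)).
Proof.
rewrite /Inv_br /= !uphalf_half /=.
have iterC s beta : Phip (iter s Phim beta) = iter s Phim (Phip beta).
  by elim: s => //= s <-; rewrite PhiC.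
by rewrite -[Phip (iter _ Phip _)]iterS iterSr -[Phim _]iterS iterSr iterC.
Qed.

Lemma Inv_br_lin d (c : scalars A) alpha beta :
  Inv_br Phip Phim d (Inv_add (Inv_scale c alpha) beta) =
  Inv_add (Inv_scale c (Inv_br Phip Phim d alpha)) (Inv_br Phip Phim d beta).
Proof.
rewrite /Inv_br; elim: (d./2) alpha beta => [|s IH] alpha beta /=.
  by elim: (uphalf d) => //= s ->; rewrite Phip_lin.
by rewrite -!iterS !iterSr Phim_lin IH.
Qed.

(** f(phi) alpha^+(q) is the difference of two values of alpha, over every
    extension; symb_descent then removes the n slots of f(phi). *)
Lemma Phip_fil m alpha : Inv_fil m alpha -> Inv_fil (m - n) (Phip alpha).
Proof.
move=> fa K q; apply: symb_descent => L h s.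
rewrite -Inv_nat -cf_f_pfister //.
have -> : cf_f A n L (pfister s) * Phip alpha L (Ipow_map h q) =
    alpha L (Ipow_map h q + pfister s) - alpha L (Ipow_map h q).
  by rewrite PhipE; [rewrite [RHS]addrC addKr | exists s].
exact: A_fil_sub.
Qed.

Lemma Phim_fil m alpha : Inv_fil m alpha -> Inv_fil (m - n) (Phim alpha).
Proof.
move=> fa K q; apply: symb_descent => L h s.
rewrite -Inv_nat -cf_f_pfister //.
have -> : cf_f A n L (pfister s) * Phim alpha L (Ipow_map h q) =
    alpha L (Ipow_map h q) - alpha L (Ipow_map h q - pfister s).
  by rewrite PhimE; [rewrite opprB [RHS]addrC subrK | exists s].
exact: A_fil_sub.
Qed.

Lemma Inv_br_fil d m alpha :
  Inv_fil m alpha -> Inv_fil (m - n * d) (Inv_br Phip Phim d alpha).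
Proof.
elim/ltn_ind: d m alpha => -[|[|d]] IH m alpha fa.
- by rewrite muln0 subn0.
- by rewrite muln1; exact: Phip_fil.
rewrite Inv_brSS !mulnS !subnDA; apply: IH => //.
by apply: Phip_fil; exact: Phim_fil.
Qed.

Definition Inv_jet alpha : seqmod A := fun d => Inv_at0 (Inv_br Phip Phim d alpha).

Definition Inv_jet0 alpha := forall d, Inv_jet alpha d = 0.

Lemma Inv_jet0_PhipPhim alpha : Inv_jet0 alpha -> Inv_jet0 (Phip (Phim alpha)).
Proof. by move=> a0 d; rewrite /Inv_jet -Inv_brSS; exact: a0. Qed.

(** In even degree 2s, (alpha^-)^[2s] is not one of the alpha^[d], but Phi_sub
    expresses it as alpha^[2s+1] - E alpha^[2s+2]; in odd degree 2s+1 it is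
    alpha^[2s+2]. *)
Lemma Inv_jet0_Phim alpha : Inv_jet0 alpha -> Inv_jet0 (Phim alpha).
Proof.
move=> a0 d; elim/ltn_ind: d alpha a0 => -[|[|d]] IH alpha a0.
- have := a0 1%N; rewrite /Inv_jet /Inv_at0 /= Phi_sub.
  have := Inv_jet0_PhipPhim a0 0%N; rewrite /Inv_jet /Inv_at0 /= => ->.
  by rewrite mulr0 addr0.
- exact: Inv_jet0_PhipPhim a0 0%N.
rewrite /Inv_jet Inv_brSS PhiC; apply: IH => //.
exact: Inv_jet0_PhipPhim.
Qed.

Lemma Inv_jet0_Phip alpha : Inv_jet0 alpha -> Inv_jet0 (Phip alpha).
Proof.
move=> a0 d.
have -> : Phip alpha = Inv_add (Inv_scale (eps A n) (Phip (Phim alpha))) (Phim alpha).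
  by apply: Inv_ext => K q; rewrite Phi_sub addrC.
have := Inv_jet0_PhipPhim a0 d; have := Inv_jet0_Phim a0 d.
by rewrite /Inv_jet Inv_br_lin /Inv_at0 /= => -> ->; rewrite mulr0 addr0.
Qed.

End Operators.

(** * The invariants g_d and the isomorphisms *)

Section Basis.
Variables (k : fieldType) (A : coefFunctor k) (n : nat).
Hypothesis char_neq2 : 2%N \notin [pchar k].
Hypothesis n_gt0 : (0 < n)%N.
Variables Phip Phim : InvI A n -> InvI A n.
Hypotheses (hPhip : is_Phi 1 Phip) (hPhim : is_Phi (-1) Phim).
Variable g : nat -> InvI A n.
Hypothesis hg : is_g Phip Phim g.
Implicit Types alpha beta : InvI A n.
Implicit Types a b : seqmod A.

Local Notation E K := (A_map A (fstruct K) (eps A n)).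
Local Notation jet := (Inv_jet Phip Phim).

Lemma fext_two_neq0 (K : fext k) : (2 : K) != 0.
Proof.
apply: contra char_neq2 => /eqP K2; rewrite inE /= -(fmorph_eq0 (fext_emb K)).
by rewrite rmorphMn rmorph1 K2.
Qed.

(** Each Pfister step changes the value by f(phi) times a value of alpha^+ or
    alpha^-, which belong to the kernel again, and f(phi) gains n >= 1 degrees. *)
Lemma Inv_jet0_fil m alpha : Inv_jet0 Phip Phim alpha -> Inv_fil m alpha.
Proof.
elim: m alpha => [|m IH] alpha a0 K; first by move=> q; exact: A_fil_full.
have step (q phi : Ipow K n) beta : Inv_fil m beta ->
    A_fil m.+1 (cf_f A n K phi * beta K q).
  move=> fbeta; apply: (@A_fil_le _ _ _ _ (n + m)).
    by rewrite -add1n leq_add2r.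
  by apply: A_fil_mul (fbeta K q); exact: cf_f_fil.
apply: (Ipow_ind (fext_two_neq0 K) n_gt0) => [|q phi Pphi fq|q phi Pphi fq].
- rewrite Inv_val0 (_ : Inv_at0 alpha = 0); last exact: (a0 0%N).
  by rewrite rmorph0; exact: A_fil_zero.
- rewrite (PhipE hPhip) //; apply: A_fil_add => //; apply: step.
  exact/IH/(Inv_jet0_Phip n_gt0 hPhip hPhim).
- rewrite (PhimE hPhim) //; apply: A_fil_sub => //; apply: step.
  exact/IH/(Inv_jet0_Phim n_gt0 hPhip hPhim).
Qed.

Lemma Inv_jet0_eq0 alpha (K : fext k) (q : Ipow K n) :
  Inv_jet0 Phip Phim alpha -> alpha K q = 0.
Proof. by move=> a0; apply: cf_separated => d; exact: Inv_jet0_fil. Qed.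

(** The value of g_{d-1}, with the convention g_{-1} = 0. *)
Definition g_pred d (K : fext k) (q : Ipow K n) : A K :=
  if d is e.+1 then g e K q else 0.

Lemma Phip_g0 : Phip (g 0%N) = Inv_scale 0 (g 0%N).
Proof.
apply: (Phip_unique n_gt0 hPhip) => K q phi _.
by rewrite /= !(g_0 hg) rmorph0 mul0r mulr0 addr0.
Qed.

Lemma Phim_g0 : Phim (g 0%N) = Inv_scale 0 (g 0%N).
Proof.
apply: (Phim_unique n_gt0 hPhim) => K q phi _.
by rewrite /= !(g_0 hg) rmorph0 mul0r mulr0 subr0.
Qed.

(** For d > 0 even this is the defining relation of the g_d; for d odd that
    relation describes g_d^- and Phi_sub turns it into g_d^+. *)
Lemma Phip_g d (K : fext k) (q : Ipow K n) :
  Phip (g d) K q = g_pred d q + (if odd d then E K * g_pred d.-1 q else 0).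
Proof.
case: d => [|d]; first by rewrite Phip_g0 /= rmorph0 mul0r addr0.
rewrite /=; case: ifP => [odd_d|/negbFE odd_d]; last by rewrite (g_odd hg) // addr0.
rewrite (Phi_sub n_gt0 hPhip hPhim) (g_even hg) //; congr (_ + _ * _).
case: d odd_d => [_|d /negbNE odd_d] /=; last by rewrite (g_odd hg).
by rewrite Phip_g0 /= rmorph0 mul0r.
Qed.

Lemma Phim_g d (K : fext k) (q : Ipow K n) :
  Phim (g d) K q = g_pred d q - (if odd d then 0 else E K * g_pred d.-1 q).
Proof.
case: d => [|d]; first by rewrite Phim_g0 /= rmorph0 mul0r mulr0 subr0.
rewrite /=; case: ifP => [odd_d|/negbFE odd_d]; first by rewrite (g_even hg) // subr0.
apply/eqP; rewrite eq_sym subr_eq; apply/eqP; rewrite -(g_odd hg) //.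
rewrite (Phi_sub n_gt0 hPhip hPhim) (PhiC n_gt0 hPhip hPhim) (g_odd hg) //.
by congr (_ + _ * _); case: d odd_d => //= d odd_d; rewrite (g_even hg).
Qed.

Lemma g_at0S d (K : fext k) : g d.+1 K 0 = 0.
Proof. by rewrite Inv_val0 (g_at0 hg) rmorph0. Qed.

(** By Phip_g and Phim_g, g_d(q + phi) and g_d(q - phi) only involve g_d(q),
    g_{d-1}(q) and g_{d-2}(q). *)
Lemma g_vanish (K : fext k) (q : Ipow K n) :
  exists D, forall d, (D <= d)%N -> g d K q = 0.
Proof.
move: q; apply: (Ipow_ind (fext_two_neq0 K) n_gt0).
- by exists 1%N => -[//|d] _; exact: g_at0S.
- move=> q phi Pphi [D HD]; exists D.+2 => -[|[|d]] // le_D_d.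
  have [H0 H1 H2] : [/\ g d K q = 0, g d.+1 K q = 0 & g d.+2 K q = 0].
    by split; apply: HD; do ?apply: leqW; exact: le_D_d.
  by rewrite (PhipE hPhip) // Phip_g /= H0 H1 H2 mulr0 if_same !addr0 mulr0 addr0.
- move=> q phi Pphi [D HD]; exists D.+2 => -[|[|d]] // le_D_d.
  have [H0 H1 H2] : [/\ g d K q = 0, g d.+1 K q = 0 & g d.+2 K q = 0].
    by split; apply: HD; do ?apply: leqW; exact: le_D_d.
  by rewrite (PhimE hPhim) // Phim_g /= H0 H1 H2 mulr0 if_same !subr0 mulr0 subr0.
Qed.

Definition g_sum_val a (K : fext k) (q : Ipow K n) : A K :=
  \sum_(d \in [set: nat]) A_map A (fstruct K) (a d) * g d K q.

Lemma g_sum_valE a D (K : fext k) (q : Ipow K n) :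
  (forall d, (D <= d)%N -> g d K q = 0) ->
  g_sum_val a q = \sum_(d < D) A_map A (fstruct K) (a d) * g d K q.
Proof.
move=> HD; rewrite (fsbig_ord _ _ (fun d => A_map A (fstruct K) (a d) * g d K q)).
apply/esym/fsbig_widen => // d [_ /negP]; rewrite -leqNgt => le_D_d /=.
by rewrite HD // mulr0.
Qed.

Lemma g_sum_nat a (K L : fext k) (h : fhom K L) (q : Ipow K n) :
  g_sum_val a (Ipow_map h q) = A_map A h (g_sum_val a q).
Proof.
have [D HD] := g_vanish q.
rewrite !(@g_sum_valE _ D) //; last by move=> d /HD Ed; rewrite Inv_nat Ed rmorph0.
rewrite rmorph_sum; apply: eq_bigr => d _; rewrite rmorphM Inv_nat; congr (_ * _).
by apply: A_map_comp => x; exact/esym/fhom_emb.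
Qed.

Definition g_sum a : InvI A n := MkInvI (g_sum_nat a).

Lemma g_sumE a D (K : fext k) (q : Ipow K n) :
  (forall d, (D <= d)%N -> g d K q = 0) ->
  g_sum a K q = \sum_(d < D) A_map A (fstruct K) (a d) * g d K q.
Proof. exact: g_sum_valE. Qed.

(** The effect of + and - on the coefficients of a sum of a_d g_d. *)
Definition shift_p a : seqmod A :=
  fun d => a d.+1 + (if odd d then eps A n * a d.+2 else 0).
Definition shift_m a : seqmod A :=
  fun d => a d.+1 - (if odd d then 0 else eps A n * a d.+2).

Lemma sum_g_pred (K : fext k) (q : Ipow K n) (b : nat -> A K) D :
  \sum_(d < D.+1) b d * g_pred d q = \sum_(d < D) b d.+1 * g d K q.
Proof. by rewrite big_ord_recl /= mulr0 add0r. Qed.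

Lemma sum_g_pred2 (K : fext k) (q : Ipow K n) (b : nat -> A K) D :
  \sum_(d < D.+2) b d * g_pred d.-1 q = \sum_(d < D) b d.+2 * g d K q.
Proof. by rewrite big_ord_recl /= mulr0 add0r big_ord_recl /= mulr0 add0r. Qed.

(** All sums are cut at a common bound D for q and its translate; the bound D + 2
    leaves room for the index shifts coming from Phip_g. *)
Lemma Phip_g_sum a : Phip (g_sum a) = g_sum (shift_p a).
Proof.
apply: (Phip_unique n_gt0 hPhip) => K q phi Pphi.
have [D1 HD1] := g_vanish q; have [D2 HD2] := g_vanish (q + phi).
pose D := maxn D1 D2.
have HD d : (D <= d)%N -> g d K q = 0 by rewrite geq_max => /andP[/HD1].
have HD' d : (D <= d)%N -> g d K (q + phi) = 0 by rewrite geq_max => /andP[_ /HD2].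
rewrite (@g_sumE _ D.+2) => [|d /ltnW/ltnW/HD' //].
rewrite (@g_sumE a D.+2 _ q) => [|d /ltnW/ltnW/HD //].
rewrite (@g_sumE _ D) //.
under eq_bigr => d _ do rewrite (PhipE hPhip) // mulrDr Phip_g.
rewrite big_split /=; congr (_ + _).
pose c d := A_map A (fstruct K) (a d) * (if odd d then E K else 0).
transitivity (cf_f A n K phi *
    (\sum_(d < D.+2) A_map A (fstruct K) (a d) * g_pred d q +
     \sum_(d < D.+2) c d * g_pred d.-1 q)).
  rewrite -big_split mulr_sumr; apply: eq_bigr => d _ /=; rewrite mulrCA mulrDr.
  by rewrite /c; case: odd; rewrite ?mulr0 ?mul0r ?mulrA.
rewrite (sum_g_pred _ (fun d => A_map A (fstruct K) (a d))) sum_g_pred2.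
rewrite big_ord_recr /= HD // mulr0 addr0 -big_split; congr (_ * _).
apply: eq_bigr => d _ /=; rewrite -mulrDl /c /shift_p /= negbK rmorphD.
by case: odd; rewrite ?rmorph0 ?mulr0 // rmorphM [E K * _]mulrC.
Qed.

Lemma Phim_g_sum a : Phim (g_sum a) = g_sum (shift_m a).
Proof.
apply: (Phim_unique n_gt0 hPhim) => K q phi Pphi.
have [D1 HD1] := g_vanish q; have [D2 HD2] := g_vanish (q - phi).
pose D := maxn D1 D2.
have HD d : (D <= d)%N -> g d K q = 0 by rewrite geq_max => /andP[/HD1].
have HD' d : (D <= d)%N -> g d K (q - phi) = 0 by rewrite geq_max => /andP[_ /HD2].
rewrite (@g_sumE _ D.+2) => [|d /ltnW/ltnW/HD' //].
rewrite (@g_sumE a D.+2 _ q) => [|d /ltnW/ltnW/HD //].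
rewrite (@g_sumE _ D) //.
under eq_bigr => d _ do rewrite (PhimE hPhim) // mulrBr Phim_g.
rewrite sumrB /=; congr (_ - _).
pose c d := A_map A (fstruct K) (a d) * (if odd d then 0 else E K).
transitivity (cf_f A n K phi *
    (\sum_(d < D.+2) A_map A (fstruct K) (a d) * g_pred d q -
     \sum_(d < D.+2) c d * g_pred d.-1 q)).
  rewrite -sumrB mulr_sumr; apply: eq_bigr => d _ /=; rewrite mulrCA mulrBr.
  by rewrite /c; case: odd; rewrite ?mulr0 ?mul0r ?mulrA.
rewrite (sum_g_pred _ (fun d => A_map A (fstruct K) (a d))) sum_g_pred2.
rewrite big_ord_recr /= HD // mulr0 addr0 -sumrB; congr (_ * _).
apply: eq_bigr => d _ /=; rewrite -mulrBl /c /shift_m /= negbK rmorphB.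
by case: odd; rewrite ?rmorph0 ?mulr0 // rmorphM [E K * _]mulrC.
Qed.

(** The correction terms of the two operators cancel. *)
Lemma shift_pm a : shift_p (shift_m a) = fun d => a d.+2.
Proof.
apply/funext => d; rewrite /shift_p /shift_m /= !negbK.
by case: odd; rewrite ?subr0 ?addr0 ?subrK.
Qed.

Lemma g_sum_at0 a : Inv_at0 (g_sum a) = a 0%N.
Proof.
rewrite /Inv_at0 (@g_sumE _ 1) => [|[//|d] _]; last exact: g_at0S.
by rewrite big_ord1 (g_0 hg) mulr1 A_map_id.
Qed.

Lemma Inv_jet_g_sum d a : jet (g_sum a) d = a d.
Proof.
rewrite /Inv_jet; elim/ltn_ind: d a => -[|[|d]] IH a.
- exact: g_sum_at0.
- by rewrite /Inv_br /= Phip_g_sum g_sum_at0 /shift_p addr0.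
by rewrite (Inv_brSS n_gt0 hPhip hPhim) Phim_g_sum Phip_g_sum shift_pm IH.
Qed.

Lemma g_sum_lin (c : scalars A) a b :
  g_sum (c *: a + b) = Inv_add (Inv_scale c (g_sum a)) (g_sum b).
Proof.
apply: Inv_ext => K q; have [D HD] := g_vanish q.
transitivity (A_map A (fstruct K) c * g_sum a K q + g_sum b K q) => //.
rewrite !(@g_sumE _ D) // mulr_sumr -big_split.
by apply: eq_bigr => d _ /=; rewrite rmorphD rmorphM mulrDl mulrA.
Qed.

Lemma Inv_jet_lin (c : scalars A) alpha beta :
  jet (Inv_add (Inv_scale c alpha) beta) = c *: jet alpha + jet beta.
Proof.
apply/funext => d; rewrite /Inv_jet (Inv_br_lin n_gt0 hPhip hPhim) /Inv_at0 /=.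
by rewrite A_map_id.
Qed.

(** The difference of both sides is in the kernel of G, as G F = id. *)
Lemma g_sum_jet alpha : g_sum (jet alpha) = alpha.
Proof.
apply: Inv_ext => K q; apply/eqP; rewrite eq_sym -subr_eq0; apply/eqP.
pose beta := Inv_add (Inv_scale (-1) (g_sum (jet alpha))) alpha.
have <- : beta K q = alpha K q - g_sum (jet alpha) K q.
  by rewrite /= rmorphN1 mulN1r addrC.
apply: Inv_jet0_eq0 => d; rewrite -[LHS]/(jet beta d) Inv_jet_lin.
rewrite -[LHS]/(-1 * jet _ d + jet _ d) Inv_jet_g_sum.
by rewrite mulN1r addNr.
Qed.

Lemma g_sum_fil m a : seqmod_fil n m a -> Inv_fil m (g_sum a).
Proof.
move=> fa K q; have [D HD] := g_vanish q; rewrite (@g_sumE _ D) //.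
apply: A_fil_sum => d; apply: (@A_fil_le _ _ _ _ (m - n * d + n * d)).
  by rewrite addnC -leq_subLR.
by apply: A_fil_mul (g_fil hg _ _); exact: A_fil_map.
Qed.

Lemma Inv_jet_fil m alpha : Inv_fil m alpha -> seqmod_fil n m (jet alpha).
Proof. by move=> fa d; exact: (Inv_br_fil n_gt0 hPhip hPhim). Qed.

End Basis.

Theorem mainTheorem3 (k : fieldType) (hk : 2%N \notin [pchar k]) (A : coefFunctor k)
    (n : nat) (hn : (0 < n)%N) (Phip Phim : InvI A n -> InvI A n)
    (hPhip : is_Phi 1 Phip) (hPhim : is_Phi (-1) Phim)
    (g : nat -> InvI A n) (hg : is_g Phip Phim g) :
  (forall (K : fext k) (q : Ipow K n), exists D : nat, forall d : nat,
     (D <= d)%N -> g d K q = 0) /\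
  exists (F : seqmod A -> InvI A n) (G : InvI A n -> seqmod A),
    [/\ forall (a : seqmod A) (K : fext k) (q : Ipow K n),
          F a K q = \sum_(d \in [set: nat]) A_map A (fstruct K) (a d) * g d K q,
        forall (alpha : InvI A n) (d : nat),
          G alpha d = Inv_at0 (Inv_br Phip Phim d alpha)
      & mutually_inverse_filtered_isos F G].
Proof.
have vanish (K : fext k) (q : Ipow K n) := g_vanish hk hn hPhip hPhim hg q.
split=> //; exists (g_sum hk hn hPhip hPhim hg), (Inv_jet Phip Phim).
split=> //; split.
- exact: g_sum_lin.
- exact: Inv_jet_lin.
- by move=> a; apply/funext => d; exact: Inv_jet_g_sum.
- exact: g_sum_jet.
- exact: g_sum_fil.
- exact: Inv_jet_fil.
Qed.
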